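(* Let $M$ be a semi-slant submanifold of a locally metallic (or, for $p=q=1$, locally Golden) Riemannian manifold $(\overline{M},\overline{g},J)$, with invariant distribution $D_1$ and slant distribution $D_2$. Then: (i) the distribution $D_1$ is integrable if and only if $$(\nabla_Y u_\alpha)(X)=(\nabla_X u_\alpha)(Y)$$ for any $X,Y\in\Gamma(D_1)$ and all $\alpha\in\{1,\dots,r\}$; (ii) the distribution $D_2$ is integrable if and only if $$P_1(\nabla_X TY-\nabla_Y TX)=\sum_{\alpha=1}^{r}\left[u_\alpha(Y)P_1(A_\alpha X)-u_\alpha(X)P_1(A_\alpha Y)\right]$$ for any $X,Y\in\Gamma(D_2)$.
   Context: $p,q$ are positive integers. A metallic Riemannian manifold $(\overline{M},\overline{g},J)$ is a Riemannian manifold with a $(1,1)$-tensor field $J$ such that $J^2=pJ+qI$ and $\overline{g}(JX,Y)=\overline{g}(X,JY)$ for all vector fields $X,Y$; it is Golden if $p=q=1$. It is locally metallic (locally Golden) if moreover $\overline{\nabla}J=0$, where $\overline{\nabla}$ is the Levi-Civita connection of $\overline{g}$. $M$ is a submanifold isometrically immersed in $\overline{M}$ with positive dimension and codimension $r\ge1$, and $\nabla$ is the Levi-Civita connection of the induced metric $g$ on $M$. Let $\{N_1,\dots,N_r\}$ be a local orthonormal frame of the normal bundle $T^\perp M$. For $X\in\Gamma(TM)$ write $JX=TX+NX=TX+\sum_{\alpha=1}^r u_\alpha(X)N_\alpha$, where $TX$ is tangent and $NX$ normal to $M$; the $u_\alpha$ are $1$-forms on $M$, and $(\nabla_Xu_\alpha)(Y)=X(u_\alpha(Y))-u_\alpha(\nabla_XY)$.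 $A_\alpha:=A_{N_\alpha}$, where the shape operator $A_V$ and normal connection $\nabla^\perp$ are given by $\overline{\nabla}_XV=-A_VX+\nabla^\perp_XV$ for $V\in\Gamma(T^\perp M)$. $M$ is a semi-slant submanifold if there are orthogonal distributions $D_1,D_2$ on $M$ with $TM=D_1\oplus D_2$, $J(D_1)=D_1$, and $D_2$ slant with angle $\theta\neq0$, i.e. the angle between $JX_x$ and $(D_2)_x$ is a constant $\theta\ne0$ for all $x\in M$ and nonzero $X_x\in(D_2)_x$. $P_1$, $P_2$ are the orthogonal projections of $TM$ onto $D_1$, $D_2$. *)

(* Defs.v *)
From HB Require Import structures.
From mathcomp Require Import all_boot all_order all_algebra.
From mathcomp Require Import all_classical all_reals all_analysis.

Set Implicit Arguments.
Unset Strict Implicit.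
Unset Printing Implicit Defensive.

Import Order.TTheory GRing.Theory Num.Theory.
Import numFieldNormedType.Exports.

Local Open Scope classical_set_scope.
Local Open Scope ring_scope.

Section Smooth.
Context {R : realType} {n : nat} {W : normedModType R}.

(* Only the values of f near the points of O matter when O is open. *)
Fixpoint Ck_on (k : nat) (O : set 'rV[R]_n) (f : 'rV[R]_n -> W) : Prop :=
  if k is k'.+1 then
    (forall a, O a -> differentiable f a) /\
    (forall v, Ck_on k' O (fun a => 'D_v f a))
  else forall a, O a -> {for a, continuous f}.

Definition smooth_on (O : set 'rV[R]_n) (f : 'rV[R]_n -> W) : Prop :=
  forall k, Ck_on k O f.

End Smooth.

Section Manifold.
Context (R : realType) (n : nat).

Record chart (T : topologicalType) := Chart {
  cdom : set T;
  cmap :> T -> 'rV[R]_n;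
  cinv : 'rV[R]_n -> T;
  cdom_open : open cdom;
  cimg_open : open (cmap @` cdom);
  cmapK : {in cdom, cancel cmap cinv};
  cmap_continuous : forall x, cdom x -> {for x, continuous cmap};
  cinv_continuous : forall a, (cmap @` cdom) a -> {for a, continuous cinv} }.

(* [chart_at x] is a preferred chart around x.  It only serves to represent
   tangent vectors: T_x M is the space 'rV[R]_n of components of tangent vectors
   in the chart [chart_at x].  No regularity of [chart_at] in x is assumed. *)
Record manifold := Manifold {
  carrier :> topologicalType;
  hausdorffM : hausdorff_space carrier;
  second_countableM : @second_countable carrier;
  atlas : set (chart carrier);
  chart_at : carrier -> chart carrier;
  atlas_chart_at : forall x, atlas (chart_at x);
  cdom_chart_at : forall x, cdom (chart_at x) x;
  atlas_smooth : forall c c', atlas c -> atlas c' ->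
    smooth_on (c @` (cdom c `&` cdom c')) (c' \o cinv c) }.

End Manifold.

Arguments chart_at {R n M} x : rename.
Arguments atlas {R n} M : rename.

Section Calculus.
Context {R : realType} {m : nat} {M : manifold R m}.

Definition smooth_fun {W : normedModType R} (U : set M) (h : M -> W) : Prop :=
  forall c, atlas M c -> smooth_on (c @` (U `&` cdom c)) (h \o cinv c).

(* the differential at x, applied to v in T_x M, of a W-valued function *)
Definition tdiff {W : normedModType R} (h : M -> W) (x : M) (v : 'rV[R]_m) : W :=
  'd (h \o cinv (chart_at x)) (chart_at x x) v.

(* the components in the chart c of v in T_x M *)
Definition tcoord (c : chart R m M) (x : M) (v : 'rV[R]_m) : 'rV[R]_m :=
  tdiff c x v.

(* [X, Y]^i = X^j d_j Y^i - Y^j d_j X^i in the chart [chart_at x] *)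
Definition lie (X Y : M -> 'rV[R]_m) (x : M) : 'rV[R]_m :=
  tdiff (fun y => tcoord (chart_at x) y (Y y)) x (X x) -
  tdiff (fun y => tcoord (chart_at x) y (X y)) x (Y x).

End Calculus.

Section Maps.
Context {R : realType} {m n : nat} {M : manifold R m} {N : manifold R n}.

Definition smooth_map (f : M -> N) : Prop :=
  continuous f /\
  forall c, atlas N c -> smooth_fun (f @^-1` cdom c) (c \o f).

(* the differential T_x M -> T_(f x) N *)
Definition dmap (f : M -> N) (x : M) (v : 'rV[R]_m) : 'rV[R]_n :=
  tdiff (chart_at (f x) \o f) x v.

(* V x is read as a vector of T_(f x) N: V is a smooth section over U of the
   pulled back bundle f^* TN.  Only the values of V on U matter. *)
Definition smooth_along (f : M -> N) (U : set M) (V : M -> 'rV[R]_n) : Prop :=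
  forall c, atlas N c ->
    smooth_fun (U `&` f @^-1` cdom c) (fun x => tcoord c (f x) (V x)).

End Maps.

Definition smooth_vfield {R : realType} {n : nat} {N : manifold R n}
    (U : set N) (X : N -> 'rV[R]_n) : Prop :=
  smooth_along (fun x : N => x) U X.

(* A connection on f^* TN, acting on local sections: [D V x v] is the derivative
   at x in the direction v in T_x M of a section V that is smooth around x;
   [D V x v] is unspecified when V is not smooth around x. *)
Record connection_along {R : realType} {m n : nat}
    {M : manifold R m} {N : manifold R n} (f : M -> N)
    (D : (M -> 'rV[R]_n) -> M -> 'rV[R]_m -> 'rV[R]_n) : Prop := {
  connection_smooth : forall U X V, open U ->
    smooth_vfield U X -> smooth_along f U V ->
    smooth_along f U (fun x => D V x (X x));
  connection_local : forall U V V' x v, open U ->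
    smooth_along f U V -> (forall y, U y -> V y = V' y) -> U x ->
    D V x v = D V' x v;
  connection_linear : forall U V x (a : R) v w, open U ->
    smooth_along f U V -> U x ->
    D V x (a *: v + w) = a *: D V x v + D V x w;
  connection_additive : forall U V V' x v, open U ->
    smooth_along f U V -> smooth_along f U V' -> U x ->
    D (fun y => V y + V' y) x v = D V x v + D V' x v;
  connection_leibniz : forall U (h : M -> R^o) V x v, open U ->
    smooth_fun U h -> smooth_along f U V -> U x ->
    D (fun y => h y *: V y) x v = tdiff h x v *: V x + h x *: D V x v }.

Section Riemannian.
Context {R : realType} {n : nat} {N : manifold R n}.

Definition bil (A : 'M[R]_n) (u v : 'rV[R]_n) : R := (u *m A *m v^T) 0 0.

(* g x is the Gram matrix of the metric on T_x N *)
Record riemannian_metric (g : N -> 'M[R]_n) : Prop := {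
  metric_smooth : forall U X Y, open U ->
    smooth_vfield U X -> smooth_vfield U Y ->
    smooth_fun U (fun x => bil (g x) (X x) (Y x) : R^o);
  metric_sym : forall x u v, bil (g x) u v = bil (g x) v u;
  metric_pos : forall x u, u != 0 -> 0 < bil (g x) u u }.

Record levi_civita (g : N -> 'M[R]_n)
    (nabla : (N -> 'rV[R]_n) -> N -> 'rV[R]_n -> 'rV[R]_n) : Prop := {
  lc_connection : connection_along (fun x : N => x) nabla;
  lc_torsion_free : forall U X Y x, open U ->
    smooth_vfield U X -> smooth_vfield U Y -> U x ->
    nabla Y x (X x) - nabla X x (Y x) = lie X Y x;
  lc_metric : forall U Y Z x v, open U ->
    smooth_vfield U Y -> smooth_vfield U Z -> U x ->
    tdiff (fun y => bil (g y) (Y y) (Z y) : R^o) x v =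
      bil (g x) (nabla Y x v) (Z x) + bil (g x) (Y x) (nabla Z x v) }.

Record metallic (p q : nat) (g : N -> 'M[R]_n) (J : N -> 'End('rV[R]_n)) :
    Prop := {
  metallic_metric : riemannian_metric g;
  metallic_smooth : forall U X, open U ->
    smooth_vfield U X -> smooth_vfield U (fun x => J x (X x));
  metallic_eq : forall x v, J x (J x v) = p%:R *: J x v + q%:R *: v;
  metallic_sym : forall x u v, bil (g x) (J x u) v = bil (g x) u (J x v) }.

(* locally Golden is the case p = q = 1 *)
Definition locally_metallic (p q : nat) (g : N -> 'M[R]_n)
    (J : N -> 'End('rV[R]_n))
    (nabla : (N -> 'rV[R]_n) -> N -> 'rV[R]_n -> 'rV[R]_n) : Prop :=
  [/\ metallic p q g J, levi_civita g nabla &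
    forall U Y x v, open U -> smooth_vfield U Y -> U x ->
      nabla (fun y => J y (Y y)) x v = J x (nabla Y x v)].

(* a smooth subbundle of TN; its rank may differ between components of N *)
Definition distribution (D : N -> {vspace 'rV[R]_n}) : Prop :=
  forall x, exists U k (E : 'I_k -> N -> 'rV[R]_n),
    [/\ open U, U x, (forall i, smooth_vfield U (E i)) &
      forall y, U y -> basis_of (D y) [tuple E i y | i < k]].

(* X is a section of D over U *)
Definition section_of (D : N -> {vspace 'rV[R]_n}) (U : set N)
    (X : N -> 'rV[R]_n) : Prop :=
  smooth_vfield U X /\ forall x, U x -> X x \in D x.

(* Integrability is closure under the bracket of (local) vector fields; by
   Frobenius this amounts to the existence of integral submanifolds. *)
Definition integrable_distribution (D : N -> {vspace 'rV[R]_n}) : Prop :=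
  forall U X Y, open U -> section_of D U X -> section_of D U Y ->
    forall x, U x -> lie X Y x \in D x.

End Riemannian.

(* The angle t between a vector w and a subspace S is the angle between w and
   its orthogonal projection s on S; cos t = |s| / |w|. *)
Definition angle_with {R : realType} {n : nat} (A : 'M[R]_n) (w : 'rV[R]_n)
    (S : set 'rV[R]_n) (t : R) : Prop :=
  exists s, [/\ S s, (forall s', S s' -> bil A (w - s) s' = 0) &
    t = acos (Num.sqrt (bil A s s) / Num.sqrt (bil A w w))].

Section Submanifold.
Context {R : realType} {m n : nat} {M : manifold R m} {N : manifold R n}.
Variables (f : M -> N) (gN : N -> 'M[R]_n) (J : N -> 'End('rV[R]_n)).

Definition isometric_immersion (g : M -> 'M[R]_m) : Prop :=
  [/\ smooth_map f, riemannian_metric g, (forall x, injective (dmap f x)) &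
    forall x u v, bil (gN (f x)) (dmap f x u) (dmap f x v) = bil (g x) u v].

(* the connection induced on f^* TN by the connection nablaN of N *)
Definition pullback_connection
    (nablaN : (N -> 'rV[R]_n) -> N -> 'rV[R]_n -> 'rV[R]_n)
    (D : (M -> 'rV[R]_n) -> M -> 'rV[R]_m -> 'rV[R]_n) : Prop :=
  connection_along f D /\
  forall U Z x v, open U -> smooth_vfield U Z -> U (f x) ->
    D (fun y => Z (f y)) x v = nablaN Z (f x) (dmap f x v).

Definition is_normal (x : M) (w : 'rV[R]_n) : Prop :=
  forall u, bil (gN (f x)) w (dmap f x u) = 0.

(* the tangential part of w in T_(f x) N, as a vector of T_x M *)
Definition tangential (x : M) (w : 'rV[R]_n) : 'rV[R]_m :=
  xget 0 [set v | is_normal x (w - dmap f x v)].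

(* J X = T X + N X *)
Definition Tpart (x : M) (v : 'rV[R]_m) : 'rV[R]_m :=
  tangential x (J (f x) (dmap f x v)).

Definition Npart (x : M) (v : 'rV[R]_m) : 'rV[R]_n :=
  J (f x) (dmap f x v) - dmap f x (Tpart x v).

(* A_V v, for D the connection on f^* TN *)
Definition shape_op (D : (M -> 'rV[R]_n) -> M -> 'rV[R]_m -> 'rV[R]_n)
    (V : M -> 'rV[R]_n) (x : M) (v : 'rV[R]_m) : 'rV[R]_m :=
  - tangential x (D V x v).

(* r is meant to be the codimension n - m, so that such a family spans the
   normal spaces. *)
Definition normal_frame (r : nat) (U : set M)
    (nu : 'I_r -> M -> 'rV[R]_n) : Prop :=
  [/\ (forall a, smooth_along f U (nu a)),
      (forall a x, U x -> is_normal x (nu a x)) &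
      forall a b x, U x -> bil (gN (f x)) (nu a x) (nu b x) = (a == b)%:R].

(* N X = sum_a u_a(X) nu_a *)
Definition normal_forms (r : nat) (U : set M) (nu : 'I_r -> M -> 'rV[R]_n)
    (u : 'I_r -> M -> 'rV[R]_m -> R^o) : Prop :=
  forall x v, U x -> Npart x v = \sum_(a < r) u a x v *: nu a x.

Record semi_slant (g : M -> 'M[R]_m) (D1 D2 : M -> {vspace 'rV[R]_m})
    (theta : R) : Prop := {
  semi_slant_D1 : distribution D1;
  semi_slant_D2 : distribution D2;
  semi_slant_orth : forall x v w, v \in D1 x -> w \in D2 x ->
    bil (g x) v w = 0;
  semi_slant_sum : forall x, (D1 x + D2 x = fullv)%VS;
  semi_slant_direct : forall x, (D1 x :&: D2 x = 0)%VS;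
  semi_slant_invariant : forall x,
    [set J (f x) (dmap f x v) | v in [set` D1 x]] =
    [set dmap f x v | v in [set` D1 x]];
  semi_slant_theta : theta != 0;
  semi_slant_angle : forall x v, v \in D2 x -> v != 0 ->
    angle_with (gN (f x)) (J (f x) (dmap f x v))
      [set dmap f x w | w in [set` D2 x]] theta }.

End Submanifold.

(* (nabla_X u)(Y) = X(u(Y)) - u(nabla_X Y) for a 1-form u *)
Definition cov_form {R : realType} {m : nat} {M : manifold R m}
    (nabla : (M -> 'rV[R]_m) -> M -> 'rV[R]_m -> 'rV[R]_m)
    (u : M -> 'rV[R]_m -> R^o) (X Y : M -> 'rV[R]_m) (x : M) : R :=
  tdiff (fun y => u y (Y y)) x (X x) - u x (nabla Y x (X x)).

(* Main.v *)
Require Import Defs.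
From HB Require Import structures.
From mathcomp Require Import all_boot all_order all_algebra.
From mathcomp Require Import all_classical all_reals all_analysis.

Set Implicit Arguments.
Unset Strict Implicit.
Unset Printing Implicit Defensive.

Import Order.TTheory GRing.Theory Num.Theory.
Import numFieldNormedType.Exports.

Local Open Scope classical_set_scope.
Local Open Scope ring_scope.

(** Write [D] for the connection on [f^* T Mbar], [T] and [sum_a u_a nu_a] for
    the tangential and normal parts of [J], and [X, Y] for two sections of the
    distribution under consideration.  Everything rests on the fact that
    [nabla_X Y - nabla_Y X] is the bracket.

    For [D1]: invariance makes [J] tangential on [D1], so every [u_a] vanishes
    on sections of [D1].  The derivative term of [(nabla_X u_a) Y] is therefore
    zero, and the two covariant derivatives differ by [- u_a (lie X Y)]
    ([cov_form_D1]).  The condition thus says that the bracket has no normal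
    part under [J].  Such vectors are exactly those of [D1] ([Npart_eq0]): a
    vector of [D2] with tangent image under [J] has that image in [D2], by
    symmetry of [J], and so would make the angle [0] with [D2].

    For [D2]: since [J] is parallel, [D_X (J Y) - D_Y (J X) = J (lie X Y)].
    Decomposing [J Y = T Y + sum_a u_a(Y) nu_a] and taking tangential parts gives
      [nabla_X (T Y) - nabla_Y (T X) = T (lie X Y)
         + sum_a (u_a(Y) A_a X - u_a(X) A_a Y)]
    ([Tpart_lie]).  So the condition says that [P1 (T (lie X Y)) = 0]; as [T]
    preserves both distributions and is injective on [D1], this means that the
    bracket lies in [D2] ([proj1_Tpart_eq0]).

    This uses three properties of [D] inherited from the Levi-Civita connection
    of the ambient manifold: it is torsion-free along [f], compatible with the
    metric, and it commutes with [J] ([pullback_torsion_free],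
    [pullback_metric], [pullback_parallel]).  Each is obtained by expanding
    sections in a coordinate frame of [Mbar].  The first two give the Gauss
    formula ([gauss_formula]): the tangential part of [D] is [nabla], by the
    uniqueness of a torsion-free metric connection.  Torsion-freeness ultimately
    depends on the symmetry of second derivatives ([schwarz]).

    Both conditions quantify over local orthonormal normal frames.  To use them
    one must know that such frames exist near every point; they come from
    extending an orthonormal tangent frame by the Gram-Schmidt process inside
    the pulled back bundle ([orthonormal_extend], [exists_normal_frame]). *)

(** * Functions of class C^k on open sets of R^n *)

(** The differential is defined by choice, so equality of the germs of [f] and
    [g] does not identify their differentials by itself; uniqueness does. *)
Lemma near_eq_differentiable {R : numFieldType} {V W : normedModType R}
    (f g : V -> W) (a : V) :
  (\near a, f a = g a) -> differentiable f a -> differentiable g a.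
Proof.
move=> fg /diff_locallyxP[cdf dfE].
have fga : f a = g a by exact: nbhs_singleton fg.
have E : g \o shift a = (cst (g a) + 'd f a) +o_ 0 id.
  apply/eqaddoP => e e0.
  have /eqaddoP/(_ e e0) H : f \o shift a = (cst (f a) + 'd f a) +o_ 0 id.
    by apply/funext => h; rewrite /= dfE.
  have fg0 : \forall h \near (0 : V), f (h + a) = g (h + a).
    by move: fg; rewrite (near_shift 0 a) /=; apply: filterS => h /=; rewrite subr0.
  by apply: filterS2 fg0 H => h /= fgh; rewrite !fctE /= fgh fga.
have dE := diff_unique cdf E.
apply/diff_locallyxP; split; first by rewrite dE.
by move=> h; have := congr1 (@^~ h) E; rewrite /= dE.
Qed.

Section Ck.
Context {R : realType} {n : nat}.
Implicit Types (k : nat) (O : set 'rV[R]_n).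

Lemma Ck_continuous {W : normedModType R} k O (f : 'rV[R]_n -> W) :
  Ck_on k O f -> forall a, O a -> {for a, continuous f}.
Proof.
case: k => [//|k] [df _] a Oa.
exact: differentiable_continuous (df a Oa).
Qed.

Lemma Ck_pred {W : normedModType R} k O (f : 'rV[R]_n -> W) :
  Ck_on k.+1 O f -> Ck_on k O f.
Proof.
elim: k f => [|k IH] f; first by move=> /Ck_continuous.
by move=> [df Df]; split=> // v; exact/IH/Df.
Qed.

Lemma Ck_sub {W : normedModType R} k O B (f : 'rV[R]_n -> W) :
  B `<=` O -> Ck_on k O f -> Ck_on k B f.
Proof.
move=> OO; elim: k f => [|k IH] f; first by move=> cf a /OO; exact: cf.
by move=> [df Df]; split=> [a /OO|v]; [exact: df|exact/IH/Df].
Qed.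

(** [Ck_on] asks for a condition at each point of the set separately, so it
    glues without any openness assumption. *)
Lemma Ck_local {W : normedModType R} k O (f : 'rV[R]_n -> W) :
  (forall a, O a -> exists B, B a /\ Ck_on k B f) -> Ck_on k O f.
Proof.
elim: k f => [|k IH] f loc.
  by move=> a /loc[B [Ba +]]; apply.
split=> [a /loc[B [Ba [df _]]]|v]; first exact: df.
by apply: IH => a /loc[B [Ba [_ Df]]]; exists B; split => //; exact: (Df v).
Qed.

(** Openness is what lets an equality of values pass to the derivatives. *)
Lemma Ck_ext {W : normedModType R} k O (f g : 'rV[R]_n -> W) :
  open O -> (forall a, O a -> f a = g a) -> Ck_on k O f -> Ck_on k O g.
Proof.
move=> oO; elim: k f g => [|k IH] f g fg.
  move=> cf a Oa; have cfa := cf a Oa.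
  have nfg : \forall b \near nbhs a, f b = g b.
    by near=> b; apply: fg; near: b; exact: open_nbhs_nbhs.
  rewrite /prop_for /continuous_at -(fg a Oa).
  exact: cvg_trans (near_eq_cvg nfg) cfa.
have nfg a : O a -> \forall b \near a, f b = g b.
  by move=> Oa; near=> b; apply: fg; near: b; exact: open_nbhs_nbhs.
move=> [df Df]; split=> [a Oa|v]; first exact: near_eq_differentiable (nfg a Oa) (df a Oa).
apply: IH (Df v) => a Oa.
exact: near_eq_derive (nfg a Oa).
Unshelve. all: by end_near. Qed.

Lemma Ck_cst {W : normedModType R} k O (c : W) : Ck_on k O (fun _ => c).
Proof.
elim: k c => [|k IH] c; first by move=> a _; exact: cst_continuous.
split=> [a _|v]; first exact: differentiable_cst.
by under eq_fun do rewrite derive_cst; exact: IH.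
Qed.

Lemma Ck_add {W : normedModType R} k O (f g : 'rV[R]_n -> W) : open O ->
  Ck_on k O f -> Ck_on k O g -> Ck_on k O (fun a => f a + g a).
Proof.
move=> oO; elim: k f g => [|k IH] f g.
  by move=> cf cg a Oa; exact: continuousD (cf a Oa) (cg a Oa).
move=> [df Df] [dg Dg]; split=> [a Oa|v].
  by apply: differentiableD; [exact: df|exact: dg].
apply: Ck_ext (IH _ _ (Df v) (Dg v)) => // a Oa.
by rewrite [RHS]deriveD//; apply: diff_derivable; [exact: df|exact: dg].
Qed.

Lemma Ck_sum {W : normedModType R} k O p (F : 'I_p -> 'rV[R]_n -> W) : open O ->
  (forall i, Ck_on k O (F i)) -> Ck_on k O (fun a => \sum_(i < p) F i a).
Proof.
move=> oO; elim: p F => [|p IH] F CF.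
  by under eq_fun do rewrite big_ord0; exact: Ck_cst.
under eq_fun do rewrite big_ord_recl.
by apply: Ck_add => //; exact: IH.
Qed.

Lemma Ck_linear {W W' : normedModType R} k O (L : {linear W -> W'})
    (f : 'rV[R]_n -> W) : open O -> continuous L ->
  Ck_on k O f -> Ck_on k O (fun a => L (f a)).
Proof.
move=> oO cL; elim: k f => [|k IH] f.
  by move=> cf a Oa; apply: (@continuous_comp _ _ _ f L); [exact: cf|exact: cL].
have dL b : differentiable L b by exact: linear_differentiable.
move=> [df Df]; split=> [a Oa|v].
  by apply: (@differentiable_comp _ _ _ _ f L) => //; exact: df.
apply: Ck_ext (IH _ (Df v)) => // a Oa.
have dLf : differentiable (L \o f) a by apply: differentiable_comp => //; exact: df.
rewrite -[RHS]/('D_v (L \o f) a) !deriveE//; last exact: df.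
by rewrite (diff_comp (df a Oa) (dL _)) /= (diff_lin _ cL).
Qed.

Lemma Ck_mul k O (f g : 'rV[R]_n -> R^o) : open O ->
  Ck_on k O f -> Ck_on k O g -> Ck_on k O (fun a => (f a : R) * (g a : R) : R^o).
Proof.
move=> oO; elim: k f g => [|k IH] f g.
  by move=> cf cg a Oa; exact: continuousM (cf a Oa) (cg a Oa).
move=> Cf Cg; have [df Df] := Cf; have [dg Dg] := Cg; split=> [a Oa|v].
  by apply: differentiableM; [exact: df|exact: dg].
apply: Ck_ext (Ck_add oO (IH _ _ (Ck_pred Cf) (Dg v))
  (IH _ _ (Ck_pred Cg) (Df v))) => // a Oa.
by rewrite [RHS]deriveM//; apply: diff_derivable; [exact: df|exact: dg].
Qed.

End Ck.

Section CkCoord.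
Context {R : realType} {n : nat}.
Implicit Types (k : nat) (O : set 'rV[R]_n).

(** The coordinates and the maps [t |-> t *: w] are packaged as linear maps so
    that [Ck_linear] reduces row-vector valued functions to real valued ones. *)
Definition coordl p (i : 'I_p) (v : 'rV[R]_p) : R^o := v 0 i.

Lemma coordl_linear p i : linear (@coordl p i).
Proof. by move=> a u v; rewrite /coordl !mxE. Qed.

HB.instance Definition _ p i :=
  GRing.isLinear.Build R 'rV[R]_p R^o _ (@coordl p i) (coordl_linear i).

Definition linel p (w : 'rV[R]_p) (t : R^o) : 'rV[R]_p := (t : R) *: w.

Lemma linel_linear p w : linear (@linel p w).
Proof. by move=> a u v; rewrite /linel scalerDl scalerA. Qed.

HB.instance Definition _ p w :=
  GRing.isLinear.Build R R^o 'rV[R]_p _ (@linel p w) (linel_linear w).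

Lemma row_delta p (v : 'rV[R]_p) : v = \sum_(i < p) v 0 i *: delta_mx 0 i.
Proof.
rewrite [LHS]matrix_sum_delta big_ord_recl big_ord0 addr0.
by apply: eq_bigr.
Qed.

Lemma Ck_coord k O p (f : 'rV[R]_n -> 'rV[R]_p) : open O ->
  Ck_on k O f -> forall i, Ck_on k O (fun a => f a 0 i : R^o).
Proof.
move=> oO Cf i; apply: (Ck_linear (L := @coordl p i)) Cf => //.
by move=> v; exact: coord_continuous.
Qed.

Lemma Ck_scale_cst k O p (h : 'rV[R]_n -> R^o) (w : 'rV[R]_p) : open O ->
  Ck_on k O h -> Ck_on k O (fun a => (h a : R) *: w).
Proof.
move=> oO Ch; apply: (Ck_linear (L := @linel p w)) Ch => //.
by move=> t; exact: scalel_continuous.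
Qed.

Lemma Ck_of_coord k O p (f : 'rV[R]_n -> 'rV[R]_p) : open O ->
  (forall i, Ck_on k O (fun a => f a 0 i : R^o)) -> Ck_on k O f.
Proof.
move=> oO Cf.
rewrite (_ : f = fun a => \sum_(i < p) f a 0 i *: delta_mx 0 i); last first.
  by apply/funext => a; exact: row_delta.
by apply: Ck_sum => // i; exact: Ck_scale_cst.
Qed.

Lemma Ck_scale k O p (h : 'rV[R]_n -> R^o) (f : 'rV[R]_n -> 'rV[R]_p) :
  open O -> Ck_on k O h -> Ck_on k O f -> Ck_on k O (fun a => (h a : R) *: f a).
Proof.
move=> oO Ch Cf; apply: Ck_of_coord => // i.
under eq_fun do rewrite mxE.
by apply: Ck_mul => //; exact: Ck_coord.
Qed.

Lemma diff_sum_derive {W : normedModType R} p (h : 'rV[R]_p -> W) b w :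
  differentiable h b ->
  'd h b w = \sum_(i < p) w 0 i *: 'D_(delta_mx 0 i) h b.
Proof.
move=> dh; rewrite {1}(row_delta w) linear_sum; apply: eq_bigr => i _.
by rewrite linearZ/= deriveE.
Qed.

Lemma derive_coord p (f : 'rV[R]_n -> 'rV[R]_p) a v i : differentiable f a ->
  'D_v (fun b => f b 0 i : R^o) a = 'D_v f a 0 i.
Proof.
move=> df; by have dv := diff_derivable df; rewrite (derive_mx (dv v)) mxE.
Qed.

(** By the chain rule, [D_v (h o phi)] is a sum of products of a coordinate of
    [D_v phi] with a composite [(D_i h) o phi]; both factors have one order of
    differentiability less, which drives the induction. *)
Lemma Ck_comp1 k O p (B : set 'rV[R]_p) (phi : 'rV[R]_n -> 'rV[R]_p)
    (h : 'rV[R]_p -> R^o) :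
  open O -> open B -> (forall a, O a -> B (phi a)) ->
  Ck_on k O phi -> Ck_on k B h -> Ck_on k O (h \o phi).
Proof.
move=> oO oB OB; elim: k h => [|k IH] h.
  move=> cphi ch a Oa; apply: continuous_comp; first exact: cphi.
  exact/ch/OB.
move=> Cphi Ch; have [dphi Dphi] := Cphi; have [dh Dh] := Ch.
split=> [a Oa|v].
  by apply: differentiable_comp; [exact: dphi|exact/dh/OB].
apply: (@Ck_ext _ _ _ _ _ (fun a => \sum_(i < p)
    (('D_v phi a 0 i : R) * ('D_(delta_mx 0 i) h \o phi) a) : R^o)) => //.
  move=> a Oa; have dpa := dphi a Oa; have dha := dh _ (OB a Oa).
  rewrite [RHS]deriveE; last exact: differentiable_comp.
  rewrite (diff_comp dpa dha) /= -(deriveE v dpa) (diff_sum_derive _ dha).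
  by apply: eq_bigr.
apply: Ck_sum => // i; apply: Ck_mul => //; first exact: (Ck_coord oO (Dphi v)).
by apply: IH (Dh _); exact: Ck_pred.
Qed.

End CkCoord.

Section CkComp.
Context {R : realType} {n : nat}.
Implicit Types (k : nat) (O : set 'rV[R]_n).

Lemma Ck_comp k O p q (B : set 'rV[R]_p) (phi : 'rV[R]_n -> 'rV[R]_p)
    (h : 'rV[R]_p -> 'rV[R]_q) :
  open O -> open B -> (forall a, O a -> B (phi a)) ->
  Ck_on k O phi -> Ck_on k B h -> Ck_on k O (h \o phi).
Proof.
move=> oO oB OB Cphi Ch; apply: Ck_of_coord => // i.
exact: Ck_comp1 oO oB OB Cphi (Ck_coord oB Ch i).
Qed.

(** Real powers cover at once the square roots and the inverses that occur in
    normalizing a vector field; the derivative of [h `^ e] involves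
    [h `^ (e - 1)], so the induction is on all exponents together. *)
Lemma Ck_powR k O (h : 'rV[R]_n -> R^o) (e : R) : open O ->
  (forall a, O a -> 0 < (h a : R)) ->
  Ck_on k O h -> Ck_on k O (fun a => (h a : R) `^ e : R^o).
Proof.
move=> oO h0; elim: k e => [|k IH] e Ch.
  move=> a Oa; apply: (@continuous_comp _ _ _ h (@powR R ^~ e)); first exact: Ch.
  apply: differentiable_continuous; apply/derivable1_diffP.
  by apply: ex_derive; exact: is_derive1_powR (h0 a Oa).
have [dh Dh] := Ch.
have dp a : O a -> differentiable (@powR R ^~ e) (h a).
  move=> Oa; apply/derivable1_diffP.
  by apply: ex_derive; exact: is_derive1_powR (h0 a Oa).
split=> [a Oa|v].
  by apply: (@differentiable_comp _ _ _ _ h (@powR R ^~ e)); [exact: dh|exact: dp].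
apply: (@Ck_ext _ _ _ _ _ (fun a => 'D_v h a *
    (e * (h a : R) `^ (e - 1)) : R^o)) => //.
  move=> a Oa; have dha := dh a Oa; have dpa := dp a Oa.
  rewrite -[RHS]/('D_v ((@powR R ^~ e) \o h) a) [RHS]deriveE; last exact: differentiable_comp.
  rewrite (diff_comp dha dpa) /= -(deriveE v dha).
  rewrite -[X in _ = 'd _ _ X]mulr1 -[_ * 1]/(_ *: (1 : R^o)) linearZ/= -deriveE//.
  by rewrite (@derive_val _ _ _ _ _ _ _ (is_derive1_powR e (h0 a Oa))).
have Ce := Ck_cst k O (e : R^o).
exact: Ck_mul oO (Dh v) (Ck_mul oO Ce (IH (e - 1) (Ck_pred Ch))).
Qed.

End CkComp.

(** * Symmetry of second derivatives *)

Section Schwarz.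
Context {R : realType} {n : nat}.
Implicit Types (O : set 'rV[R]_n) (f : 'rV[R]_n -> R^o).

(** Restriction of a function to a line, to bring in the one-variable mean
    value theorem. *)
Lemma is_derive_slice f (b v : 'rV[R]_n) (s : R) : derivable f (b + s *: v) v ->
  is_derive s 1 (fun t : R => f (b + t *: v) : R) ('D_v f (b + s *: v)).
Proof.
move=> df.
have E : (fun h : R => h^-1 *: (((fun t : R => f (b + t *: v) : R) \o shift s) (h *: 1)
    - f (b + s *: v) : R^o)) =
  (fun h : R => h^-1 *: ((f \o shift (b + s *: v)) (h *: v) - f (b + s *: v))).
  apply/funext => h /=; congr (_ *: (f _ - _)).
  by rewrite -[h *: 1]/(h * 1) mulr1 scalerDl addrCA.
apply: DeriveDef; first by rewrite /derivable E.
by rewrite /derive E.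
Qed.

Lemma MVT0 (g dg : R -> R) (t : R) : 0 < t ->
  (forall s, 0 <= s <= t -> is_derive s 1 g (dg s)) ->
  exists2 d, 0 <= d <= t & g t - g 0 = dg d * t.
Proof.
move=> t0 dgP.
have [d dt gE] : exists2 d, d \in `]0, t[ & g t - g 0 = dg d * (t - 0).
  apply: (@MVT R g dg 0 t) => // [s|].
    by rewrite in_itv/= => /andP[s0 st]; apply: dgP; rewrite (ltW s0) (ltW st).
  apply: derivable_within_continuous => s; rewrite in_itv/= => st.
  by have [] := dgP s st.
move: dt gE; rewrite in_itv/= => /andP[d0 dt]; rewrite subr0 => gE.
by exists d => //; rewrite (ltW d0) (ltW dt).
Qed.

(** The second difference over a small parallelogram, by the mean value theorem
    in the direction [v] and then in the direction [w].  It is symmetric in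
    [v] and [w], which is the source of [schwarz]. *)
Lemma second_difference O f (a v w : 'rV[R]_n) (t : R) : 0 < t ->
  (forall c d : R, 0 <= c <= t -> 0 <= d <= t -> O (a + c *: v + d *: w)) ->
  Ck_on 2 O f ->
  exists c d : R, [/\ 0 <= c <= t, 0 <= d <= t &
    f (a + t *: v + t *: w) - f (a + t *: v) - f (a + t *: w) + f a =
    'D_w ('D_v f) (a + c *: v + d *: w) * t * t].
Proof.
move=> t0 Oa [df Df].
have t_itv : 0 <= t <= t by rewrite lexx ltW.
have z_itv : 0 <= (0 : R) <= t by rewrite lexx ltW.
have dv c d : 0 <= c <= t -> 0 <= d <= t -> derivable f (a + d *: w + c *: v) v.
  by move=> ct dt; apply: diff_derivable; apply: df; rewrite addrAC; exact: Oa.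
(* the increment along [w], as a function of the position along [v]; the term
     [0 *: w] gives both values the form that [dv] covers *)
pose phi (s : R) : R := f (a + t *: w + s *: v) - f (a + 0 *: w + s *: v).
pose dphi (s : R) : R := 'D_v f (a + t *: w + s *: v) - 'D_v f (a + 0 *: w + s *: v).
have dphiP s : 0 <= s <= t -> is_derive s 1 phi (dphi s).
  by move=> st; apply: is_deriveB; apply: is_derive_slice; exact: dv.
have [c c_itv phiE] := MVT0 t0 dphiP.
pose psi (s : R) : R := 'D_v f (a + c *: v + s *: w).
pose dpsi (s : R) : R := 'D_w ('D_v f) (a + c *: v + s *: w).
have dpsiP s : 0 <= s <= t -> is_derive s 1 psi (dpsi s).
  move=> st; apply: is_derive_slice; apply: diff_derivable.
  by have [+ _] := Df v; apply; exact: Oa.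
have [d d_itv psiE] := MVT0 t0 dpsiP.
exists c, d; split => //.
have -> : f (a + t *: v + t *: w) - f (a + t *: v) - f (a + t *: w) + f a = phi t - phi 0.
  rewrite /phi !scale0r !addr0 (addrAC a (t *: w)) opprB addrA.
  by rewrite -!addrA; congr (_ + (_ + _)); rewrite addrC.
rewrite phiE; congr (_ * _); rewrite -/(dpsi d) -psiE /psi /dphi.
by rewrite scale0r !addr0 (addrAC a).
Qed.

Lemma continuous_meet (F1 F2 : 'rV[R]_n -> R^o) (a : 'rV[R]_n) :
  {for a, continuous F1} -> {for a, continuous F2} ->
  (forall d, 0 < d -> exists b b',
    [/\ ball a d b, ball a d b' & F1 b = F2 b']) -> F1 a = F2 a.
Proof.
move=> c1 c2 meet; apply/eqP; rewrite -subr_eq0 -normr_le0.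
apply/ler_addgt0Pr => e e0; rewrite add0r.
have e2 : 0 < e / 2 by rewrite divr_gt0.
have H1 : \forall b \near a, `|F1 a - F1 b| < e / 2.
  by move/cvgrPdist_lt : c1; exact.
have H2 : \forall b \near a, `|F2 a - F2 b| < e / 2.
  by move/cvgrPdist_lt : c2; exact.
have /nbhs_ballP[d1 /= d10 dP1] := H1.
have /nbhs_ballP[d2 /= d20 dP2] := H2.
have d0 : 0 < Num.min d1 d2 by rewrite lt_min d10.
have [b [b' [bb bb' E]]] := meet _ d0.
have Hb : `|F1 a - F1 b| < e / 2.
  by apply: dP1; apply: le_ball bb; rewrite ge_min lexx.
have Hb' : `|F2 a - F2 b'| < e / 2.
  by apply: dP2; apply: le_ball bb'; rewrite ge_min lexx orbT.
rewrite E in Hb; rewrite distrC in Hb'.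
have := ltrD Hb Hb'; rewrite -splitr => /ltW; apply: le_trans.
by rewrite (le_trans _ (ler_normD _ _))// addrA subrK.
Qed.

(** Exchanging [v] and [w] in [second_difference] shows that the two mixed
    derivatives share a value at points arbitrarily close to [a]; both are
    continuous. *)
Lemma schwarz O f (a v w : 'rV[R]_n) : open O -> O a -> Ck_on 2 O f ->
  'D_w ('D_v f) a = 'D_v ('D_w f) a.
Proof.
move=> oO Oa C2.
have [_ Df] := C2.
have cD x y : {for a, continuous ('D_x ('D_y f))}.
  by have [_ D2] := Df y; exact: (D2 x).
apply: continuous_meet (cD w v) (cD v w) _ => d' d'0.
have : \forall b \near a, O b by exact: open_nbhs_nbhs.
move=> /nbhs_ballP[d'' /= d''0 dO].
pose d := Num.min d' d''.
have d0 : 0 < d by rewrite lt_min d'0.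
have dP b : ball a d b -> O b.
  by move=> bb; apply: dO; apply: le_ball bb; rewrite ge_min lexx orbT.
have dd' b : ball a d b -> ball a d' b.
  by apply: le_ball; rewrite ge_min lexx.
(* the parallelogram of sides [t *: v] and [t *: w] stays within [d] of [a];
   the summand [1] covers the case [v = w = 0] *)
pose t := d / (2 * (`|v| + `|w| + 1)).
have N0 : 0 < `|v| + `|w| + 1 by rewrite ltr_wpDl// addr_ge0.
have t0 : 0 < t by rewrite divr_gt0// mulr_gt0.
have near_a c c' (x y : 'rV[R]_n) : `|x| + `|y| = `|v| + `|w| ->
    0 <= c <= t -> 0 <= c' <= t -> ball a d (a + c *: x + c' *: y).
  move=> xy /andP[c0 ct] /andP[c'0 c't].
  rewrite -ball_normE /= opprD addrA opprD addNKr distrC opprK.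
  rewrite (le_lt_trans (ler_normD _ _))// !normrZ !ger0_norm//.
  have : c * `|x| + c' * `|y| <= t * (`|v| + `|w| + 1).
    rewrite -xy (@le_trans _ _ (t * `|x| + t * `|y|))//.
      by apply: lerD; apply: ler_wpM2r.
    by rewrite -mulrDr; apply: ler_wpM2l; [exact: ltW|rewrite lerDl ler01].
  rewrite addrC => /le_lt_trans; apply.
  rewrite /t invfM mulrA mulrAC -mulrA divff ?gt_eqF// mulr1.
  by rewrite ltr_pdivrMr// ltr_pMr// ltr1n.
have [c [d1 [ct dt E1]]] := @second_difference O f a v w t t0
  (fun c d hc hd => dP _ (near_a _ _ _ _ erefl hc hd)) C2.
have [c' [d1' [ct' dt' E2]]] := @second_difference O f a w v t t0
  (fun c d hc hd => dP _ (near_a _ _ _ _ (addrC _ _) hc hd)) C2.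
exists (a + c *: v + d1 *: w), (a + c' *: w + d1' *: v); split.
- exact/dd'/near_a.
- by apply/dd'/near_a => //; rewrite addrC.
have tn0 : t != 0 by rewrite gt_eqF.
apply: (mulIf tn0); apply: (mulIf tn0).
apply: (etrans (esym E1)); apply: etrans E2; rewrite (addrAC a); congr (_ + _).
by rewrite -!addrA; congr (_ + _); rewrite addrC.
Qed.

End Schwarz.

(** * Smooth functions on a manifold *)

Lemma near_eq_diff {R : numFieldType} {V W : normedModType R}
    (f g : V -> W) (a v : V) :
  (\near a, f a = g a) -> differentiable f a -> 'd f a v = 'd g a v.
Proof.
move=> fg df; rewrite -!deriveE//; first exact: near_eq_derive.
exact: near_eq_differentiable fg df.
Qed.

Lemma diff_chain {R : numFieldType} {V1 V2 V3 : normedModType R}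
    (f : V1 -> V2) (g : V2 -> V3) (a v : V1) (b : V2) :
  f a = b -> differentiable f a -> differentiable g b ->
  'd g b ('d f a v) = 'd (g \o f) a v.
Proof. by move=> <- df dg; rewrite (diff_comp df dg). Qed.

Section Charts.
Context {R : realType} {m : nat} {M : manifold R m}.
Implicit Types (U : set M) (c : chart R m M) (x : M).

Lemma chartK c x : cdom c x -> cinv c (c x) = x.
Proof. by move=> cx; apply: (cmapK (c := c)); rewrite inE. Qed.

Lemma open_chart_image c U : open U -> open (c @` (U `&` cdom c)).
Proof.
move=> oU.
have -> : c @` (U `&` cdom c) = c @` cdom c `&` cinv c @^-1` U.
  apply/seteqP; split=> [a [x [Ux cx] <-]|a [[x cx <-]]].
    by split; [exists x|rewrite /= chartK].
  by rewrite /= chartK// => Ux; exists x.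
rewrite openE => a [ca Ua].
have oc := @cimg_open _ _ _ c.
apply: filterI; first exact: open_nbhs_nbhs.
exact: (cinv_continuous ca) (open_nbhs_nbhs (conj oU Ua)).
Qed.

Lemma smooth_fun_sub {W : normedModType R} U U' (h : M -> W) :
  U' `<=` U -> smooth_fun U h -> smooth_fun U' h.
Proof.
move=> UU sh c cA k; apply: Ck_sub (sh c cA k).
by move=> a [x [U'x cx] <-]; exists x => //; split => //; exact: UU.
Qed.

Lemma smooth_fun_local {W : normedModType R} U (h : M -> W) :
  (forall x, U x -> exists V, V x /\ smooth_fun V h) -> smooth_fun U h.
Proof.
move=> loc c cA k; apply: Ck_local => a [x [Ux cx] <-].
have [V [Vx sV]] := loc x Ux.
by exists (c @` (V `&` cdom c)); split; [exists x|exact: sV].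
Qed.

Lemma smooth_fun_ext {W : normedModType R} U (h h' : M -> W) : open U ->
  (forall x, U x -> h x = h' x) -> smooth_fun U h -> smooth_fun U h'.
Proof.
move=> oU hh' sh c cA k; apply: Ck_ext (sh c cA k).
  exact: open_chart_image.
by move=> a [x [Ux cx] <-] /=; rewrite chartK// hh'.
Qed.

Lemma smooth_fun_cst {W : normedModType R} U (w : W) : smooth_fun U (fun _ => w).
Proof. by move=> c cA k; exact: Ck_cst. Qed.

Lemma smooth_fun_add {W : normedModType R} U (h h' : M -> W) : open U ->
  smooth_fun U h -> smooth_fun U h' -> smooth_fun U (fun x => h x + h' x).
Proof.
move=> oU sh sh' c cA k.
by apply: (Ck_add _ (sh c cA k) (sh' c cA k)); exact: open_chart_image.
Qed.

Lemma smooth_fun_sum {W : normedModType R} U p (F : 'I_p -> M -> W) : open U ->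
  (forall i, smooth_fun U (F i)) -> smooth_fun U (fun x => \sum_(i < p) F i x).
Proof.
move=> oU sF c cA k.
apply: (Ck_sum (F := fun i => F i \o cinv c)); first exact: open_chart_image.
by move=> i; exact: sF.
Qed.

Lemma smooth_fun_mul U (h h' : M -> R^o) : open U ->
  smooth_fun U h -> smooth_fun U h' ->
  smooth_fun U (fun x => (h x : R) * (h' x : R) : R^o).
Proof.
move=> oU sh sh' c cA k.
by apply: (Ck_mul _ (sh c cA k) (sh' c cA k)); exact: open_chart_image.
Qed.

Lemma smooth_fun_powR U (h : M -> R^o) (e : R) : open U ->
  (forall x, U x -> 0 < (h x : R)) -> smooth_fun U h ->
  smooth_fun U (fun x => (h x : R) `^ e : R^o).
Proof.
move=> oU h0 sh c cA k.
apply: (Ck_powR (h := h \o cinv c)) (sh c cA k); first exact: open_chart_image.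
by move=> a [x [Ux cx] <-] /=; rewrite chartK//; exact: h0.
Qed.

Lemma smooth_fun_coord p U (h : M -> 'rV[R]_p) : open U -> smooth_fun U h ->
  forall i, smooth_fun U (fun x => h x 0 i : R^o).
Proof.
move=> oU sh i c cA k.
by apply: (Ck_coord _ (sh c cA k)); exact: open_chart_image.
Qed.

Lemma smooth_fun_of_coord p U (h : M -> 'rV[R]_p) : open U ->
  (forall i, smooth_fun U (fun x => h x 0 i : R^o)) -> smooth_fun U h.
Proof.
move=> oU sh c cA k; apply: Ck_of_coord; first exact: open_chart_image.
by move=> i; exact: sh.
Qed.

Lemma smooth_fun_scale p U (h : M -> R^o) (w : M -> 'rV[R]_p) : open U ->
  smooth_fun U h -> smooth_fun U w -> smooth_fun U (fun x => (h x : R) *: w x).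
Proof.
move=> oU sh sw c cA k.
by apply: (Ck_scale _ (sh c cA k) (sw c cA k)); exact: open_chart_image.
Qed.

Lemma smooth_chart c : atlas M c -> smooth_fun (cdom c) c.
Proof. by move=> cA c' c'A; rewrite setIC; exact: atlas_smooth. Qed.

Lemma smooth_fun_diff {W : normedModType R} U c x (h : M -> W) :
  atlas M c -> U x -> cdom c x -> smooth_fun U h ->
  differentiable (h \o cinv c) (c x).
Proof. by move=> cA Ux cx sh; have [+ _] := sh c cA 1%N; apply; exists x. Qed.

Lemma smooth_fun_continuous {W : normedModType R} U x (h : M -> W) :
  open U -> U x -> smooth_fun U h -> {for x, continuous h}.
Proof.
move=> oU Ux sh.
pose c : chart R m M := chart_at x; have cx : cdom c x := cdom_chart_at x.
have dh := smooth_fun_diff (atlas_chart_at x) Ux cx sh.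
have H : {for x, continuous ((h \o cinv c) \o c)}.
  apply: continuous_comp; first exact: cmap_continuous.
  exact: differentiable_continuous.
rewrite /prop_for /continuous_at /= chartK// in H.
apply: cvg_trans H; apply: near_eq_cvg.
have : \forall y \near x, cdom c y by apply: open_nbhs_nbhs; split => //; exact: cdom_open.
by apply: filterS => y cy /=; rewrite chartK.
Qed.

(** Transfers a property of points of [M] near [x] to a property of coordinates
    near [c x]. *)
Lemma near_chart c x U (P : 'rV[R]_m -> Prop) : open U -> U x -> cdom c x ->
  (forall y, U y -> cdom c y -> P (c y)) -> \forall a \near c x, P a.
Proof.
move=> oU Ux cx UP; have oi := open_chart_image (c := c) oU.
have : \forall a \near c x, (c @` (U `&` cdom c)) a.
  by apply: open_nbhs_nbhs; split => //; exists x.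
by apply: filterS => _ [y [Uy cy] <-]; exact: UP.
Qed.

(** The chain rule for a change of charts.  Tangent vectors are represented in
    a preferred chart at each point, and this lemma is what makes every
    construction independent of that preference. *)
Lemma diff_transition {W : normedModType R} U c1 c2 x (h : M -> W) w :
  open U -> U x -> smooth_fun U h -> atlas M c1 -> atlas M c2 ->
  cdom c1 x -> cdom c2 x ->
  'd (h \o cinv c1) (c1 x) ('d (c1 \o cinv c2) (c2 x) w) =
  'd (h \o cinv c2) (c2 x) w.
Proof.
move=> oU Ux sh c1A c2A c1x c2x.
have d1 := smooth_fun_diff c2A c1x c2x (smooth_chart c1A).
have d2 := smooth_fun_diff c1A Ux c1x sh.
have E : (c1 \o cinv c2) (c2 x) = c1 x by rewrite /= chartK.
transitivity ('d ((h \o cinv c1) \o (c1 \o cinv c2)) (c2 x) w).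
  exact: (@diff_chain R _ _ _ (c1 \o cinv c2) (h \o cinv c1) _ w (c1 x) E d1 d2).
apply: near_eq_diff; last by apply: differentiable_comp; rewrite ?E.
apply: (near_chart (@cdom_open _ _ _ c1)) => //= y c1y c2y.
by rewrite !chartK.
Qed.

Lemma diff_chart_id c x w : cdom c x -> 'd (c \o cinv c) (c x) w = w.
Proof.
move=> cx.
have H : \forall a \near c x, id a = (c \o cinv c) a.
  apply: (near_chart (@cdom_open _ _ _ c)) => //= y _ cy.
  by rewrite chartK.
have did : differentiable (@id 'rV[R]_m) (c x) by exact: ex_diff.
by rewrite -(near_eq_diff w H did) -deriveE// derive_id.
Qed.

End Charts.

(** * Tangent vectors in charts *)

Section TangentVectors.
Context {R : realType} {m : nat} {M : manifold R m}.
Implicit Types (U : set M) (c : chart R m M) (x : M) (v w : 'rV[R]_m).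

Lemma tdiffP {W : normedModType R} (h : M -> W) x (a : R) v w :
  tdiff h x (a *: v + w) = a *: tdiff h x v + tdiff h x w.
Proof. by rewrite /tdiff linearP. Qed.

Lemma tdiffB {W : normedModType R} (h : M -> W) x v w :
  tdiff h x (v - w) = tdiff h x v - tdiff h x w.
Proof. by rewrite /tdiff linearB. Qed.

Lemma smooth_fun_diff_at {W : normedModType R} U x (h : M -> W) :
  U x -> smooth_fun U h ->
  differentiable (h \o cinv (chart_at x)) (chart_at x x).
Proof.
move=> Ux; apply: smooth_fun_diff => //; first exact: atlas_chart_at.
exact: cdom_chart_at.
Qed.

(** Smoothness is needed on one side only, the equality near [x] carrying it
    over to the other. *)
Lemma tdiff_ext {W : normedModType R} U x (h h' : M -> W) v :
  open U -> U x -> smooth_fun U h -> (forall y, U y -> h y = h' y) ->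
  tdiff h x v = tdiff h' x v.
Proof.
move=> oU Ux sh hh'; apply: near_eq_diff; last exact: smooth_fun_diff_at sh.
apply: (near_chart oU) => //=; first exact: cdom_chart_at.
by move=> y Uy cy; rewrite chartK// hh'.
Qed.

Lemma tdiff_chart {W : normedModType R} U c x (h : M -> W) v :
  open U -> U x -> smooth_fun U h -> atlas M c -> cdom c x ->
  tdiff h x v = 'd (h \o cinv c) (c x) (tcoord c x v).
Proof.
move=> oU Ux sh cA cx.
exact/esym/(diff_transition v oU Ux sh cA (atlas_chart_at x) cx (cdom_chart_at x)).
Qed.

Lemma tdiff_cst {W : normedModType R} (w : W) x v : tdiff (fun _ => w) x v = 0.
Proof.
by rewrite /tdiff (_ : _ \o _ = cst w)// diff_cst.
Qed.

Lemma tdiffD {W : normedModType R} U x (h h' : M -> W) v :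
  U x -> smooth_fun U h -> smooth_fun U h' ->
  tdiff (fun y => h y + h' y) x v = tdiff h x v + tdiff h' x v.
Proof.
move=> Ux sh sh'; have dh := smooth_fun_diff_at Ux sh.
have dh' := smooth_fun_diff_at Ux sh'.
by rewrite /tdiff -[RHS](congr1 (@^~ v) (diffD dh dh')).
Qed.

Lemma tdiff_sum {W : normedModType R} U x p (F : 'I_p -> M -> W) v :
  open U -> U x -> (forall i, smooth_fun U (F i)) ->
  tdiff (fun y => \sum_(i < p) F i y) x v = \sum_(i < p) tdiff (F i) x v.
Proof.
move=> oU Ux; elim: p F => [|p IH] F sF.
  rewrite big_ord0; under [fun y => _]eq_fun do rewrite big_ord0.
  exact: tdiff_cst.
under [fun y => _]eq_fun do rewrite big_ord_recl.
by rewrite big_ord_recl (tdiffD _ Ux)//; [rewrite IH|exact: smooth_fun_sum].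
Qed.

Lemma tdiffM U x (h h' : M -> R^o) v :
  U x -> smooth_fun U h -> smooth_fun U h' ->
  tdiff (fun y => (h y : R) * (h' y : R) : R^o) x v =
  (tdiff h x v : R) * (h' x : R) + (h x : R) * (tdiff h' x v : R) :> R.
Proof.
move=> Ux sh sh'; have dh := smooth_fun_diff_at Ux sh.
have dh' := smooth_fun_diff_at Ux sh'.
have dM : differentiable ((h \o cinv (chart_at x)) * (h' \o cinv (chart_at x)))
    (chart_at x x) by exact: differentiableM.
rewrite /tdiff -[LHS]/('d ((h \o cinv (chart_at x)) * (h' \o cinv (chart_at x)))
  (chart_at x x) v) -!deriveE// deriveM; try exact: diff_derivable.
rewrite /= chartK; last exact: cdom_chart_at.
by rewrite addrC; congr (_ + _); rewrite -[_ *: _]/(_ * _) mulrC.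
Qed.

Lemma tdiff_coord U x p (h : M -> 'rV[R]_p) v i : U x -> smooth_fun U h ->
  tdiff (fun y => h y 0 i : R^o) x v = tdiff h x v 0 i.
Proof.
move=> Ux sh; have dh := smooth_fun_diff_at Ux sh.
rewrite /tdiff -[in RHS]deriveE// -derive_coord// deriveE//.
apply: (@differentiable_comp _ _ _ _ (h \o cinv (chart_at x))
  (fun N : 'rV[R]_p => N 0 i : R^o)) => //.
exact: differentiable_coord.
Qed.

(** The inverse of [tcoord c x]. *)
Definition tvec c x w : 'rV[R]_m := 'd (chart_at x \o cinv c) (c x) w.

Lemma tcoord_at x v : tcoord (chart_at x) x v = v.
Proof. by rewrite /tcoord /tdiff diff_chart_id//; exact: cdom_chart_at. Qed.

Lemma tdiff_tvec {W : normedModType R} U c x (h : M -> W) w :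
  open U -> U x -> smooth_fun U h -> atlas M c -> cdom c x ->
  tdiff h x (tvec c x w) = 'd (h \o cinv c) (c x) w.
Proof.
move=> oU Ux sh cA cx.
exact: (diff_transition w oU Ux sh (atlas_chart_at x) cA (cdom_chart_at x) cx).
Qed.

Lemma tvecK c x w : atlas M c -> cdom c x -> tcoord c x (tvec c x w) = w.
Proof.
move=> cA cx; rewrite /tcoord (tdiff_tvec _ (@cdom_open _ _ _ c))//.
- exact: diff_chart_id.
- exact: smooth_chart.
Qed.

Lemma tcoordK c x v : atlas M c -> cdom c x -> tvec c x (tcoord c x v) = v.
Proof.
move=> cA cx; rewrite /tvec -(tdiff_chart _ (@cdom_open _ _ _ (chart_at x)))//.
- exact: tcoord_at.
- exact: cdom_chart_at.
- exact/smooth_chart/atlas_chart_at.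
Qed.

Lemma tcoordP c x (a : R) v w :
  tcoord c x (a *: v + w) = a *: tcoord c x v + tcoord c x w.
Proof. exact: tdiffP. Qed.

(** Vector fields with constant components in a chart are smooth; in another
    chart their components are directional derivatives of the transition map. *)
Lemma smooth_tvec c w : atlas M c -> smooth_vfield (cdom c) (fun y => tvec c y w).
Proof.
move=> cA c' c'A c'' c''A k; rewrite /preimage /=.
have E : smooth_fun (cdom c `&` cdom c') (fun y => tcoord c' y (tvec c y w)).
  move=> d dA j.
  have dc : smooth_fun (cdom c `&` cdom c') c.
    by apply: smooth_fun_sub (smooth_chart cA) => y [].
  have oI : open (cdom c `&` cdom c') by apply: openI; exact: cdom_open.
  have H := dc d dA j.
  have c'c := atlas_smooth cA c'A j.+1.
  have [_ /(_ w) Dc'] := c'c.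
  have oc : open (c @` (cdom c `&` cdom c')).
    by rewrite setIC; apply: open_chart_image; exact: cdom_open.
  apply: (@Ck_ext _ _ _ _ _ ('D_w (c' \o cinv c) \o (c \o cinv d))).
  - exact: open_chart_image.
  - move=> _ [y [[cy c'y] dy] <-] /=; rewrite chartK// /tcoord.
    rewrite (tdiff_tvec _ (@cdom_open _ _ _ c'))//; last exact: smooth_chart.
    have [+ _] := c'c => /(_ (c y)) dd; rewrite deriveE//; apply: dd.
    by exists y.
  - apply: (Ck_comp _ oc _ H Dc'); first exact: open_chart_image.
    by move=> _ [y [[cy c'y] dy] <-] /=; rewrite chartK//; exists y.
exact: E.
Qed.

End TangentVectors.

(** * Vector fields as derivations *)

Section VectorFields.
Context {R : realType} {m : nat} {M : manifold R m}.
Implicit Types (U : set M) (x : M).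

Lemma smooth_map_id : smooth_map (fun x : M => x).
Proof. split=> [x|c cA c' c'A]; first by [].
exact: (smooth_chart cA c'A). Qed.

Lemma smooth_fun_tdiff U (X : M -> 'rV[R]_m) (h : M -> R^o) : open U ->
  smooth_vfield U X -> smooth_fun U h ->
  smooth_fun U (fun x => tdiff h x (X x)).
Proof.
move=> oU sX sh c cA k.
have oUc : open (U `&` cdom c) by apply: openI => //; exact: cdom_open.
have [_ Dh] := sh c cA k.+1.
have := sX c cA c cA k; rewrite /preimage /= -setIA setIid => sXc.
have oc := open_chart_image (c := c) oU.
apply: (@Ck_ext _ _ _ _ _ (fun a => \sum_(i < m)
  (((fun y => tcoord c y (X y)) \o cinv c) a 0 i : R) *
    ('D_(delta_mx 0 i) (h \o cinv c) a : R) : R^o)) => //.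
  move=> _ [y [Uy cy] <-] /=; rewrite chartK//.
  have dh := smooth_fun_diff cA Uy cy sh.
  rewrite [RHS](tdiff_chart _ oU Uy sh cA cy) (diff_sum_derive _ dh).
  by apply: eq_bigr.
apply: (Ck_sum (F := fun i a => (((fun y => tcoord c y (X y)) \o cinv c) a 0 i : R) *
    ('D_(delta_mx 0 i) (h \o cinv c) a : R) : R^o)) => // i.
exact: Ck_mul oc (Ck_coord oc sXc i) (Dh _).
Qed.

Lemma smooth_fun_tdiff_row U (X : M -> 'rV[R]_m) p (h : M -> 'rV[R]_p) : open U ->
  smooth_vfield U X -> smooth_fun U h ->
  smooth_fun U (fun x => tdiff h x (X x)).
Proof.
move=> oU sX sh; apply: smooth_fun_of_coord => // i.
apply: smooth_fun_ext (smooth_fun_tdiff oU sX (smooth_fun_coord oU sh i)) => //.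
by move=> x Ux; exact: tdiff_coord sh.
Qed.

(** The iterated derivative [X (Y h)] in the preferred chart at [x]: a first
    order term, in which the components of [Y] are differentiated, and a second
    order term, in which the components of [X] and [Y] only enter by their
    values at [x]. *)
Lemma tdiff_tdiff U (X Y : M -> 'rV[R]_m) (h : M -> R^o) x : open U -> U x ->
  smooth_vfield U Y -> smooth_fun U h ->
  let c := chart_at x in
  tdiff (fun y => tdiff h y (Y y)) x (X x) =
  tdiff h x (tdiff (fun y => tcoord c y (Y y)) x (X x)) +
  \sum_(i < m) \sum_(j < m) (Y x 0 i : R) * (X x 0 j : R) *
    'D_(delta_mx 0 j) ('D_(delta_mx 0 i) (h \o cinv c)) (c x) :> R.
Proof.
move=> oU Ux sY sh c;
have cA : atlas M c := atlas_chart_at x.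
have cx : cdom c x := cdom_chart_at x.
pose V := U `&` cdom c.
have oV : open V by apply: openI => //; exact: cdom_open.
have Vx : V x by split.
have sVh : smooth_fun V h by apply: smooth_fun_sub sh => y [].
have sYc : smooth_fun V (fun y => tcoord c y (Y y)) by exact: sY.
(* the partial derivatives of [h], as functions on [M] *)
pose Dh i (y : M) : R^o := tdiff h y (tvec c y (delta_mx 0 i)).
have sDh i : smooth_fun V (Dh i).
  apply: smooth_fun_tdiff => //.
  move=> d dA; apply: smooth_fun_sub (smooth_tvec (delta_mx 0 i) cA dA).
  by move=> y [[_ cy] dy].
have sYi := smooth_fun_coord oV sYc.
have E : forall y, V y -> \sum_(i < m) ((tcoord c y (Y y) 0 i : R) * (Dh i y : R) : R^o)
    = tdiff h y (Y y).
  move=> y [Uy cy]; rewrite (tdiff_chart _ oU Uy sh cA cy).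
  have dh := smooth_fun_diff cA Uy cy sh.
  rewrite (diff_sum_derive _ dh); apply: eq_bigr => i _.
  by rewrite /Dh (tdiff_tvec _ oU Uy sh cA cy) -deriveE.
have sF i : smooth_fun V (fun y => (tcoord c y (Y y) 0 i : R) * (Dh i y : R) : R^o).
  exact: smooth_fun_mul.
rewrite -(tdiff_ext _ oV Vx (smooth_fun_sum oV sF) E).
rewrite (tdiff_sum _ oV Vx sF).
under eq_bigr do rewrite (tdiffM _ Vx (sYi _) (sDh _)).
rewrite big_split /=; congr (_ + _).
  have dh := smooth_fun_diff cA Ux cx sh.
  rewrite [RHS](diff_sum_derive _ dh); apply: eq_bigr => i _.
  rewrite (tdiff_coord _ _ Vx sYc) /Dh (tdiff_tvec _ oU Ux sh cA cx).
  by rewrite -deriveE.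
apply: eq_bigr => i _; rewrite tcoord_at.
have [_ /(_ (delta_mx 0 i)) D1] := sh c cA 2%N.
have oc := open_chart_image (c := c) oU.
have Dc : smooth_on (c @` (V `&` cdom c)) ('D_(delta_mx 0 i) (h \o cinv c)).
  move=> k; have [_ /(_ (delta_mx 0 i)) Dk] := sh c cA k.+1.
  by apply: Ck_sub Dk => a [y [[Uy cy] _] <-]; exists y.
have dD : differentiable ('D_(delta_mx 0 i) (h \o cinv c)) (c x).
  by have [+ _] := Dc 1%N; apply; exists x.
have -> : tdiff (Dh i) x (X x) = 'd ('D_(delta_mx 0 i) (h \o cinv c)) (c x) (X x).
  symmetry; apply: (near_eq_diff _ _ dD).
  apply: (near_chart oV) => //= y [Uy cy] _.
  rewrite chartK// /Dh (tdiff_tvec _ oU Uy sh cA cy) -deriveE//.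
  exact: smooth_fun_diff sh.
rewrite (diff_sum_derive _ dD) mulr_sumr; apply: eq_bigr => j _.
by rewrite -mulrA.
Qed.

(** The bracket is the commutator of derivations: the second derivatives of
    [h] in the two iterated derivatives cancel by symmetry. *)
Lemma tdiff_lie U (X Y : M -> 'rV[R]_m) (h : M -> R^o) x : open U -> U x ->
  smooth_vfield U X -> smooth_vfield U Y -> smooth_fun U h ->
  (tdiff (fun y => tdiff h y (Y y)) x (X x) : R) -
  (tdiff (fun y => tdiff h y (X y)) x (Y x) : R) = tdiff h x (lie X Y x).
Proof.
move=> oU Ux sX sY sh.
rewrite (tdiff_tdiff X oU Ux sY sh) (tdiff_tdiff Y oU Ux sX sh).
set S := \sum_(i < m) _; set S' := \sum_(i < m) _.
have cA : atlas M (chart_at x) := atlas_chart_at x.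
have cUx : (chart_at x @` (U `&` cdom (chart_at x))) (chart_at x x).
  by exists x => //; split => //; exact: cdom_chart_at.
have oc := open_chart_image (c := chart_at x) oU.
have -> : S = S'.
  rewrite /S exchange_big /=; apply: eq_bigr => i _; apply: eq_bigr => j _.
  exact: (congr2 *%R (mulrC _ _)
    (schwarz (delta_mx 0 j) (delta_mx 0 i) oc cUx (sh _ cA 2%N))).
rewrite /lie tdiffB.
by rewrite opprD addrACA subrr addr0.
Qed.

End VectorFields.

(** * Sections of a pulled back tangent bundle *)

Section Along.
Context {R : realType} {m n : nat} {M : manifold R m} {N : manifold R n}.
Variables (f : M -> N) (hf : smooth_map f).
Implicit Types (U : set M) (O : set N) (c : chart R m M) (C : chart R n N).

Lemma open_preimage O : open O -> open (f @^-1` O).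
Proof. by move=> oO; apply: open_comp => // x _; have [+ _] := hf; apply. Qed.

(** Locally [h o f] is the composite of the coordinate expressions of [h] and
    [f], read in charts at [x] and [f x]. *)
Lemma smooth_fun_comp O (h : N -> R^o) : open O ->
  smooth_fun O h -> smooth_fun (f @^-1` O) (h \o f).
Proof.
move=> oO sh c cA k; apply: Ck_local => _ [x [Ofx cx] <-].
pose C : chart R n N := chart_at (f x).
have CA : atlas N C := atlas_chart_at (f x).
have oV : open (f @^-1` (O `&` cdom C)).
  by apply: open_preimage; apply: openI => //; exact: cdom_open.
exists (c @` (f @^-1` (O `&` cdom C) `&` cdom c)); split.
  by exists x => //; split=> //; split => //; exact: cdom_chart_at.
apply: (@Ck_ext _ _ _ _ _ ((h \o cinv C) \o ((C \o f) \o cinv c))).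
- exact: open_chart_image.
- by move=> _ [y [[Ofy Cy] cy] <-] /=; rewrite !chartK.
- apply: (Ck_comp1 _ _ _ _ (sh C CA k)).
  + exact: open_chart_image.
  + exact: open_chart_image.
  + move=> _ [y [[Ofy Cy] cy] <-] /=; rewrite chartK//.
    by exists (f y).
  + apply: Ck_sub (proj2 hf C CA c cA k).
    by move=> _ [y [[Ofy Cy] cy] <-]; exists y.
Qed.

Lemma smooth_fun_comp_row p O (h : N -> 'rV[R]_p) : open O ->
  smooth_fun O h -> smooth_fun (f @^-1` O) (h \o f).
Proof.
move=> oO sh; apply: smooth_fun_of_coord; first exact: open_preimage.
move=> i; exact: (smooth_fun_comp oO (smooth_fun_coord oO sh i)).
Qed.

(** The chain rule for [dmap], whose definition passes through the preferred
    chart at [f x]. *)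
Lemma tdiff_comp {W : normedModType R} O (h : N -> W) x v : open O -> O (f x) ->
  smooth_fun O h -> tdiff (h \o f) x v = tdiff h (f x) (dmap f x v).
Proof.
move=> oO Ofx sh.
pose c : chart R m M := chart_at x; pose C : chart R n N := chart_at (f x).
have CA : atlas N C := atlas_chart_at (f x).
have cx : cdom c x := cdom_chart_at x.
have Cx : cdom C (f x) := cdom_chart_at (f x).
have sCf := proj2 hf C CA.
have d1 := smooth_fun_diff (atlas_chart_at x) (Cx : (f @^-1` cdom C) x) cx sCf.
have d2 := smooth_fun_diff CA Ofx Cx sh.
have E : ((C \o f) \o cinv c) (c x) = C (f x) by rewrite /= chartK.
rewrite [RHS](@diff_chain R _ _ _ ((C \o f) \o cinv c) (h \o cinv C) _ v
  (C (f x)) E d1 d2).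
symmetry; apply: near_eq_diff.
  apply: (near_chart (open_preimage (@cdom_open _ _ _ C))) => //= y Cy cy.
  by rewrite !chartK.
by apply: differentiable_comp; rewrite ?E.
Qed.

Lemma smooth_along_sub U U' (V : M -> 'rV[R]_n) : U' `<=` U ->
  smooth_along f U V -> smooth_along f U' V.
Proof.
by move=> UU sV C CA; apply: smooth_fun_sub (sV C CA) => x [/UU].
Qed.

Lemma open_along U C : open U -> open (U `&` f @^-1` cdom C).
Proof. by move=> oU; apply: openI => //; apply: open_preimage; exact: cdom_open. Qed.

Lemma smooth_along_ext U (V V' : M -> 'rV[R]_n) : open U ->
  (forall x, U x -> V x = V' x) -> smooth_along f U V -> smooth_along f U V'.
Proof.
move=> oU VV' sV C CA; apply: smooth_fun_ext (sV C CA); first exact: open_along.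
by move=> x [Ux _]; rewrite VV'.
Qed.

Lemma smooth_along_local U (V : M -> 'rV[R]_n) :
  (forall x, U x -> exists B : set M, B x /\ smooth_along f B V) -> smooth_along f U V.
Proof.
move=> loc C CA; apply: smooth_fun_local => x [Ux Cx].
by have [B [Bx sV]] := loc x Ux; exists (B `&` f @^-1` cdom C); split; [|exact: sV].
Qed.

Lemma smooth_along_add U (V V' : M -> 'rV[R]_n) : open U ->
  smooth_along f U V -> smooth_along f U V' ->
  smooth_along f U (fun x => V x + V' x).
Proof.
move=> oU sV sV' C CA; have oUC := open_along C oU.
apply: smooth_fun_ext (smooth_fun_add oUC (sV C CA) (sV' C CA)) => // x _.
by rewrite -[V x in RHS]scale1r tcoordP scale1r.
Qed.

Lemma smooth_along_scale U (h : M -> R^o) (V : M -> 'rV[R]_n) : open U ->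
  smooth_fun U h -> smooth_along f U V ->
  smooth_along f U (fun x => (h x : R) *: V x).
Proof.
move=> oU sh sV C CA; have oUC := open_along C oU.
have sh' : smooth_fun (U `&` f @^-1` cdom C) h.
  by apply: smooth_fun_sub sh => x [].
apply: smooth_fun_ext (smooth_fun_scale oUC sh' (sV C CA)) => // x _.
by rewrite /tcoord /tdiff linearZ.
Qed.

Lemma smooth_along0 U : smooth_along f U (fun _ => 0).
Proof.
move=> C CA; rewrite (_ : (fun x => _) = fun=> 0); first exact: smooth_fun_cst.
by apply/funext => x; rewrite /tcoord /tdiff linear0.
Qed.

Lemma smooth_along_sum U p (F : 'I_p -> M -> 'rV[R]_n) : open U ->
  (forall i, smooth_along f U (F i)) ->
  smooth_along f U (fun x => \sum_(i < p) F i x).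
Proof.
move=> oU; elim: p F => [|p IH] F sF.
  by under [fun x => _]eq_fun do rewrite big_ord0; exact: smooth_along0.
under [fun x => _]eq_fun do rewrite big_ord_recl.
by apply: smooth_along_add => //; exact: IH.
Qed.

Lemma smooth_along_comp O (Z : N -> 'rV[R]_n) : open O ->
  smooth_vfield O Z -> smooth_along f (f @^-1` O) (fun x => Z (f x)).
Proof.
move=> oO sZ C CA.
have oOC : open (O `&` cdom C) by apply: openI => //; exact: cdom_open.
exact: smooth_fun_comp_row oOC (sZ C CA).
Qed.

Lemma smooth_along_dmap U (X : M -> 'rV[R]_m) : open U -> smooth_vfield U X ->
  smooth_along f U (fun x => dmap f x (X x)).
Proof.
move=> oU sX C CA; have oUC := open_along C oU.
have sX' : smooth_vfield (U `&` f @^-1` cdom C) X.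
  by move=> c cA; apply: smooth_fun_sub (sX c cA) => x [[]].
have sCf : smooth_fun (U `&` f @^-1` cdom C) (C \o f).
  by apply: smooth_fun_sub (proj2 hf C CA) => x [].
apply: smooth_fun_ext (smooth_fun_tdiff_row oUC sX' sCf) => // x [_ Cx].
exact: tdiff_comp (@cdom_open _ _ _ C) Cx (smooth_chart CA).
Qed.

(** A chart of [N] trivializes the pulled back bundle; by this expansion, what
    is bilinear over functions or satisfies a Leibniz rule only has to be
    computed on the coordinate fields. *)
Lemma along_expand C x (w : 'rV[R]_n) : atlas N C -> cdom C (f x) ->
  w = \sum_(i < n) tcoord C (f x) w 0 i *: tvec C (f x) (delta_mx 0 i).
Proof.
move=> CA Cx; rewrite -{1}(tcoordK w CA Cx) {1}(row_delta (tcoord C (f x) w)).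
rewrite /tvec linear_sum; apply: eq_bigr => i _.
by rewrite linearZ.
Qed.

End Along.

(** * Bilinear forms *)

Section Bil.
Context {R : realType} {n : nat}.
Implicit Types (A : 'M[R]_n) (u v w : 'rV[R]_n).

Lemma bilDl A u v w : bil A (u + v) w = bil A u w + bil A v w.
Proof. by rewrite /bil !mulmxDl mxE. Qed.

Lemma bilDr A u v w : bil A u (v + w) = bil A u v + bil A u w.
Proof. by rewrite /bil linearD /= mulmxDr mxE. Qed.

Lemma bilZl A (a : R) u v : bil A (a *: u) v = a * bil A u v.
Proof. by rewrite /bil -!scalemxAl mxE. Qed.

Lemma bilZr A (a : R) u v : bil A u (a *: v) = a * bil A u v.
Proof. by rewrite /bil linearZ /= -scalemxAr mxE. Qed.

Lemma bilBl A u v w : bil A (u - v) w = bil A u w - bil A v w.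
Proof. by rewrite bilDl -scaleN1r bilZl mulN1r. Qed.

Lemma bil0l A u : bil A 0 u = 0.
Proof. by rewrite -(scale0r 0) bilZl mul0r. Qed.

Lemma bil0r A u : bil A u 0 = 0.
Proof. by rewrite -(scale0r 0) bilZr mul0r. Qed.

Lemma bil_suml A (I : finType) (P : pred I) (F : I -> 'rV[R]_n) u :
  bil A (\sum_(i | P i) F i) u = \sum_(i | P i) bil A (F i) u.
Proof.
by apply: (big_morph (bil A ^~ u)) => [v w|]; [exact: bilDl|exact: bil0l].
Qed.

Lemma bil_sumr A (I : finType) (P : pred I) (F : I -> 'rV[R]_n) u :
  bil A u (\sum_(i | P i) F i) = \sum_(i | P i) bil A u (F i).
Proof.
by apply: (big_morph (bil A u)) => [v w|]; [exact: bilDr|exact: bil0r].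
Qed.

End Bil.

(** * Connections along a map *)

Section Connection.
Context {R : realType} {m n : nat} {M : manifold R m} {N : manifold R n}.
Variables (f : M -> N) (hf : smooth_map f).
Variable D : (M -> 'rV[R]_n) -> M -> 'rV[R]_m -> 'rV[R]_n.
Hypothesis hD : connection_along f D.
Variables (U : set M) (x : M).
Hypotheses (oU : open U) (Ux : U x).

(** [D] is only constrained on smooth sections, so even its value at the zero
    section has to come from additivity. *)
Lemma connection0 v : D (fun _ => 0) x v = 0.
Proof.
have s0 := smooth_along0 f U.
have := connection_additive hD v oU s0 s0 Ux.
under [fun y : M => 0 + 0]eq_fun do rewrite addr0.
by move=> /eqP; rewrite -subr_eq subrr => /eqP <-.
Qed.

Lemma connection_sum p (F : 'I_p -> M -> 'rV[R]_n) v :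
  (forall i, smooth_along f U (F i)) ->
  D (fun y => \sum_(i < p) F i y) x v = \sum_(i < p) D (F i) x v.
Proof.
elim: p F => [|p IH] F sF.
  by under [fun y => _]eq_fun do rewrite big_ord0; rewrite big_ord0 connection0.
under [fun y => _]eq_fun do rewrite big_ord_recl.
rewrite big_ord_recl (connection_additive hD _ oU) ?IH//.
exact: smooth_along_sum.
Qed.

Lemma connection_lincomb (V : M -> 'rV[R]_n) p (a : 'I_p -> R)
    (w : 'I_p -> 'rV[R]_m) : smooth_along f U V ->
  D V x (\sum_(i < p) a i *: w i) = \sum_(i < p) a i *: D V x (w i).
Proof.
move=> sV.
have D0 : D V x 0 = 0.
  have := connection_linear hD 1 0 0 oU sV Ux.
  by rewrite !scale1r addr0 => /eqP; rewrite -subr_eq subrr => /eqP <-.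
elim: p a w => [|p IH] a w; first by rewrite !big_ord0.
by rewrite !big_ord_recl (connection_linear hD _ _ _ oU sV Ux) IH.
Qed.

End Connection.

Section Pullback.
Context {R : realType} {m n : nat} {M : manifold R m} {N : manifold R n}.
Variables (f : M -> N) (hf : smooth_map f).
Variables (nablaN : (N -> 'rV[R]_n) -> N -> 'rV[R]_n -> 'rV[R]_n)
  (D : (M -> 'rV[R]_n) -> M -> 'rV[R]_m -> 'rV[R]_n).
Hypothesis hD : pullback_connection f nablaN D.
Implicit Types (U : set M) (O : set N).

(** On restrictions of ambient vector fields, [D] is the ambient connection; the
    Leibniz rule then determines it on their combinations. *)
Lemma pullback_sum U O x v p (h : 'I_p -> M -> R^o) (Z : 'I_p -> N -> 'rV[R]_n) :
  open U -> U x -> open O -> O (f x) ->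
  (forall i, smooth_fun U (h i)) -> (forall i, smooth_vfield O (Z i)) ->
  D (fun y => \sum_(i < p) (h i y : R) *: Z i (f y)) x v =
  \sum_(i < p) ((tdiff (h i) x v : R) *: Z i (f x) +
    (h i x : R) *: nablaN (Z i) (f x) (dmap f x v)).
Proof.
move=> oU Ux oO Ofx sh sZ; have [cD eD] := hD.
have oB : open (U `&` f @^-1` O) by apply: openI => //; exact: open_preimage.
have Bx : (U `&` f @^-1` O) x by [].
have sh' i : smooth_fun (U `&` f @^-1` O) (h i).
  by apply: smooth_fun_sub (sh i) => y [].
have sZ' i : smooth_along f (U `&` f @^-1` O) (fun y => Z i (f y)).
  apply: smooth_along_sub (smooth_along_comp hf oO (sZ i)).
  by move=> y [].
rewrite (connection_sum hf cD oB Bx); last first.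
  by move=> i; exact: smooth_along_scale.
apply: eq_bigr => i _; rewrite (connection_leibniz cD _ oB (sh' i) (sZ' i) Bx).
by rewrite (eD O).
Qed.

(** The components of a section [V] along [f], in the preferred chart at the
    image of the fixed point [x]. *)
Definition along_coef (x : M) (V : M -> 'rV[R]_n) (i : 'I_n) (y : M) : R^o :=
  tcoord (chart_at (f x)) (f y) (V y) 0 i.

Definition coord_field (p : N) (i : 'I_n) (q : N) : 'rV[R]_n :=
  tvec (chart_at p) q (delta_mx 0 i).

Definition chart_nbhs (U : set M) (x : M) := U `&` f @^-1` cdom (chart_at (f x)).

Lemma open_chart_nbhs U x : open U -> open (chart_nbhs U x).
Proof. exact: open_along. Qed.

Lemma chart_nbhs_self U x : U x -> chart_nbhs U x x.
Proof. by split => //; exact: cdom_chart_at. Qed.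

Lemma chart_nbhs_sub U x : chart_nbhs U x `<=` U.
Proof. by move=> y []. Qed.

Lemma smooth_coord_field p i : smooth_vfield (cdom (chart_at p)) (coord_field p i).
Proof. exact/smooth_tvec/atlas_chart_at. Qed.

Lemma smooth_along_coef U x V i : open U -> smooth_along f U V ->
  smooth_fun (chart_nbhs U x) (along_coef x V i).
Proof.
move=> oU sV; apply: smooth_fun_coord; first exact: open_chart_nbhs.
exact/sV/atlas_chart_at.
Qed.

Lemma along_coefE U x V y : chart_nbhs U x y ->
  \sum_(i < n) (along_coef x V i y : R) *: coord_field (f x) i (f y) = V y.
Proof. by move=> [_ Cy]; rewrite -along_expand//; exact: atlas_chart_at. Qed.

(** The expression of [D] by Christoffel symbols in a coordinate frame of [N]. *)
Lemma pullbackE U x V v : open U -> U x -> smooth_along f U V ->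
  D V x v = \sum_(i < n) ((tdiff (along_coef x V i) x v : R) *: coord_field (f x) i (f x) +
    (along_coef x V i x : R) *: nablaN (coord_field (f x) i) (f x) (dmap f x v)).
Proof.
move=> oU Ux sV; have [cD eD] := hD.
rewrite -(pullback_sum (U := chart_nbhs U x) (O := cdom (chart_at (f x)))).
- have oUx := open_chart_nbhs x oU.
  have sV' := smooth_along_sub (@chart_nbhs_sub U x) sV.
  apply: (connection_local cD _ oUx sV'); last exact: chart_nbhs_self.
  by move=> y Uy; rewrite (along_coefE _ Uy).
- exact: open_chart_nbhs.
- exact: chart_nbhs_self.
- exact: cdom_open.
- exact: cdom_chart_at.
- by move=> i; exact: smooth_along_coef.
- by move=> i; exact: smooth_coord_field.
Qed.

End Pullback.

(** * The pullback of a Levi-Civita connection *)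

Section PullbackLeviCivita.
Context {R : realType} {m n : nat} {M : manifold R m} {N : manifold R n}.
Variables (f : M -> N) (hf : smooth_map f).
Variables (gN : N -> 'M[R]_n) (hgN : riemannian_metric gN).
Implicit Types (U : set M) (O : set N) (V W : M -> 'rV[R]_n).

Lemma smooth_gram U V W : open U -> smooth_along f U V -> smooth_along f U W ->
  smooth_fun U (fun y => bil (gN (f y)) (V y) (W y) : R^o).
Proof.
move=> oU sV sW; apply: smooth_fun_local => x Ux.
exists (chart_nbhs f U x); split; first exact: chart_nbhs_self.
have oB := open_chart_nbhs hf x oU.
pose E i := @coord_field R n N (f x) i.
have oC : open (cdom (chart_at (f x))) := @cdom_open _ _ _ _.
have sE i : smooth_vfield (cdom (chart_at (f x))) (E i) := smooth_coord_field _ _.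
pose a i := along_coef f x V i; pose b i := along_coef f x W i.
have sa i : smooth_fun (chart_nbhs f U x) (a i) := smooth_along_coef hf _ _ oU sV.
have sb i : smooth_fun (chart_nbhs f U x) (b i) := smooth_along_coef hf _ _ oU sW.
have sG i j : smooth_fun (chart_nbhs f U x)
    (fun y => bil (gN (f y)) (E i (f y)) (E j (f y)) : R^o).
  apply: smooth_fun_sub (smooth_fun_comp hf oC (metric_smooth hgN oC (sE i) (sE j))).
  by move=> y [].
apply: (@smooth_fun_ext _ _ _ _ _ (fun y => \sum_(i < n) \sum_(j < n)
    ((a i y : R) * ((b j y : R) * bil (gN (f y)) (E i (f y)) (E j (f y)) : R) : R^o))).
- exact: oB.
- move=> y By; rewrite -(along_coefE V By) -(along_coefE W By).
  rewrite bil_suml; apply: eq_bigr => i _; rewrite bilZl bil_sumr mulr_sumr.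
  by apply: eq_bigr => j _; rewrite bilZr.
- apply: smooth_fun_sum => // i; apply: smooth_fun_sum => // j.
  by apply: smooth_fun_mul => //; exact: smooth_fun_mul.
Qed.

Variables (nablaN : (N -> 'rV[R]_n) -> N -> 'rV[R]_n -> 'rV[R]_n)
  (D : (M -> 'rV[R]_n) -> M -> 'rV[R]_m -> 'rV[R]_n).
Hypotheses (hN : levi_civita gN nablaN) (hD : pullback_connection f nablaN D).

Definition compatible_at V W x v :=
  tdiff (fun y => bil (gN (f y)) (V y) (W y) : R^o) x v =
  bil (gN (f x)) (D V x v) (W x) + bil (gN (f x)) (V x) (D W x v) :> R.

(** Metric compatibility only has to be checked against restrictions of vector
    fields of the ambient manifold, since these span all sections locally. *)
Lemma compatible_expand U x V W v : open U -> U x ->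
  smooth_along f U V -> smooth_along f U W ->
  (forall i, compatible_at V (fun y => coord_field (f x) i (f y)) x v) ->
  compatible_at V W x v.
Proof.
move=> oU Ux sV sW cVE; have [cD eD] := hD.
have oB := open_chart_nbhs hf x oU.
have Bx := chart_nbhs_self f Ux.
pose E i := @coord_field R n N (f x) i.
have oC : open (cdom (chart_at (f x))) := @cdom_open _ _ _ _.
have sE i : smooth_vfield (cdom (chart_at (f x))) (E i) := smooth_coord_field _ _.
have sEf i : smooth_along f (chart_nbhs f U x) (fun y => E i (f y)).
  by apply: smooth_along_sub (smooth_along_comp hf oC (sE i)) => y [].
have sVB := smooth_along_sub (@chart_nbhs_sub _ _ _ _ _ f U x) sV.
pose b i := along_coef f x W i.
have sb i : smooth_fun (chart_nbhs f U x) (b i) := smooth_along_coef hf _ _ oU sW.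
have sG i : smooth_fun (chart_nbhs f U x)
    (fun y => bil (gN (f y)) (V y) (E i (f y)) : R^o) := smooth_gram oB sVB (sEf i).
have sF i : smooth_fun (chart_nbhs f U x)
    (fun y => (b i y : R) * bil (gN (f y)) (V y) (E i (f y)) : R^o).
  exact: smooth_fun_mul.
rewrite /compatible_at.
have -> : tdiff (fun y => bil (gN (f y)) (V y) (W y) : R^o) x v =
    tdiff (fun y => \sum_(i < n)
      ((b i y : R) * bil (gN (f y)) (V y) (E i (f y)) : R^o)) x v.
  symmetry; apply: (tdiff_ext _ oB Bx (smooth_fun_sum oB sF)) => y By.
  rewrite -(along_coefE W By) bil_sumr.
  by apply: eq_bigr => i _; rewrite bilZr.
rewrite (tdiff_sum _ oB Bx sF) (pullbackE hf hD _ oU Ux sW).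
rewrite -[W x in RHS](along_coefE W Bx) !bil_sumr -big_split /=.
apply: eq_bigr => i _; rewrite (tdiffM _ Bx (sb i) (sG i)).
rewrite (cVE i) bilDr !bilZr mulrDr addrCA; congr (_ + (_ + _)).
by rewrite (eD (cdom (chart_at (f x))))//; exact: cdom_chart_at.
Qed.

Lemma compatible_sym V W x v : compatible_at V W x v -> compatible_at W V x v.
Proof.
rewrite /compatible_at.
under [fun y => _]eq_fun do rewrite (Defs.metric_sym hgN).
by rewrite addrC => ->; congr (_ + _); rewrite (Defs.metric_sym hgN).
Qed.

Lemma pullback_metric U x V W v : open U -> U x ->
  smooth_along f U V -> smooth_along f U W -> compatible_at V W x v.
Proof.
move=> oU Ux sV sW; have [cD eD] := hD.
have oB := open_chart_nbhs hf x oU.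
have Bx := chart_nbhs_self f Ux.
pose E i := @coord_field R n N (f x) i.
have oC : open (cdom (chart_at (f x))) := @cdom_open _ _ _ _.
have Cx : cdom (chart_at (f x)) (f x) := cdom_chart_at _.
have sE i : smooth_vfield (cdom (chart_at (f x))) (E i) := smooth_coord_field _ _.
have sEf i : smooth_along f (chart_nbhs f U x) (fun y => E i (f y)).
  by apply: smooth_along_sub (smooth_along_comp hf oC (sE i)) => y [].
have sVB := smooth_along_sub (@chart_nbhs_sub _ _ _ _ _ f U x) sV.
apply: (compatible_expand oU Ux sV sW) => i.
apply: compatible_sym; apply: (compatible_expand oB Bx (sEf i) sVB) => j.
rewrite /compatible_at.
rewrite [LHS](tdiff_comp hf _ oC Cx (metric_smooth hgN oC (sE i) (sE j))).
rewrite (lc_metric hN _ oC (sE i) (sE j) Cx).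
by rewrite !(eD (cdom (chart_at (f x)))).
Qed.

(** The components of coordinate fields in their own chart are constant. *)
Lemma coord_field_commute x i j :
  lie (coord_field (f x) i) (coord_field (f x) j) (f x) = 0.
Proof.
rewrite /lie; set c := chart_at (f x).
have cA : atlas N c := atlas_chart_at _.
have cx : cdom c (f x) := cdom_chart_at _.
have H k w : tdiff (fun y => tcoord c y (coord_field (f x) k y)) (f x) w = 0.
  rewrite -(tdiff_ext (U := cdom c) (h := fun _ => delta_mx 0 k)).
  - exact: tdiff_cst.
  - exact: cdom_open.
  - exact: cx.
  - exact: smooth_fun_cst.
  - by move=> y cy; rewrite /coord_field tvecK.
by rewrite !H subrr.
Qed.

(** In a coordinate frame [E_i] of [N], with [phi_i] the components of [f],
    [D_X (df Y)] is [sum_i X (Y phi_i) E_i] plus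
    [sum_ij (Y phi_i) (X phi_j) nablaN_(E_j) E_i].  The second sum is symmetric
    in [X] and [Y] because the [E_i] commute, and the first sums differ by
    [df] of the bracket, by [tdiff_lie]. *)
Lemma pullback_torsion_free U x (X Y : M -> 'rV[R]_m) : open U -> U x ->
  smooth_vfield U X -> smooth_vfield U Y ->
  D (fun y => dmap f y (Y y)) x (X x) - D (fun y => dmap f y (X y)) x (Y x) =
  dmap f x (lie X Y x).
Proof.
move=> oU Ux sX sY; have [cD eD] := hD.
have cN := lc_connection hN.
pose C := chart_at (f x).
have CA : atlas N C := atlas_chart_at _.
have Cx : cdom C (f x) := cdom_chart_at _.
have oC : open (cdom C) := @cdom_open _ _ _ _.
have oB := open_chart_nbhs hf x oU.
have Bx := chart_nbhs_self f Ux.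
pose E i := @coord_field R n N (f x) i.
have sE i : smooth_vfield (cdom C) (E i) := smooth_coord_field _ _.
have sXB : smooth_vfield (chart_nbhs f U x) X.
  exact: smooth_along_sub (@chart_nbhs_sub _ _ _ _ _ f U x) sX.
have sYB : smooth_vfield (chart_nbhs f U x) Y.
  exact: smooth_along_sub (@chart_nbhs_sub _ _ _ _ _ f U x) sY.
have sC : smooth_fun (chart_nbhs f U x) (C \o f).
  by apply: smooth_fun_sub (proj2 hf C CA) => y [].
pose phi i (y : M) : R^o := (C \o f) y 0 i.
have sphi i : smooth_fun (chart_nbhs f U x) (phi i) := smooth_fun_coord oB sC i.
have coefE (Z : M -> 'rV[R]_m) i y : chart_nbhs f U x y ->
    along_coef f x (fun y => dmap f y (Z y)) i y = tdiff (phi i) y (Z y).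
  move=> By; have [_ Cy] := By; rewrite (tdiff_coord _ _ By sC).
  by rewrite (tdiff_comp hf _ oC Cy (smooth_chart CA)).
have dE v : dmap f x v = \sum_(i < n) (tdiff (phi i) x v : R) *: E i (f x).
  rewrite -(along_coefE (fun y => dmap f y v) Bx).
  by apply: eq_bigr => i _; rewrite (coefE (fun=> v) _ _ Bx).
have DE (Z : M -> 'rV[R]_m) v : smooth_vfield U Z ->
    smooth_vfield (chart_nbhs f U x) Z ->
    D (fun y => dmap f y (Z y)) x v = \sum_(i < n)
      ((tdiff (fun y => tdiff (phi i) y (Z y)) x v : R) *: E i (f x)) +
    \sum_(i < n) \sum_(j < n) ((tdiff (phi i) x (Z x) : R) * (tdiff (phi j) x v : R)) *:
       nablaN (E i) (f x) (E j (f x)).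
  move=> sZ sZB; rewrite (pullbackE hf hD _ oU Ux (smooth_along_dmap hf oU sZ)).
  have e1 i : tdiff (along_coef f x (fun y => dmap f y (Z y)) i) x v =
      tdiff (fun y => tdiff (phi i) y (Z y)) x v.
    symmetry; apply: (tdiff_ext _ oB Bx (smooth_fun_tdiff oB sZB (sphi i))) => y By.
    exact: esym (coefE _ _ _ By).
  rewrite -big_split /=; apply: eq_bigr => i _.
  rewrite e1; apply: (congr1 (+%R _)).
  rewrite (coefE _ _ _ Bx) {1}dE (connection_lincomb cN oC Cx _ _ (sE i)) scaler_sumr.
  by apply: eq_bigr => j _; rewrite scalerA.
rewrite (DE Y _ sY sYB) (DE X _ sX sXB).
set S := \sum_(i < n) \sum_(j < n) _; set S' := \sum_(i < n) \sum_(j < n) _.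
have -> : S = S'.
  rewrite /S exchange_big /=; apply: eq_bigr => i _; apply: eq_bigr => j _.
  rewrite [X in X *: _]mulrC; congr (_ *: _).
  apply/eqP; rewrite -subr_eq0; apply/eqP.
  by rewrite (lc_torsion_free hN oC (sE i) (sE j) Cx) coord_field_commute.
rewrite opprD addrACA subrr addr0 dE -sumrB; apply: eq_bigr => i _.
by rewrite -scalerBl (tdiff_lie oB Bx sXB sYB (sphi i)).
Qed.

Lemma smooth_along_endo (J : N -> 'End('rV[R]_n)) U V :
  (forall O X, open O -> smooth_vfield O X -> smooth_vfield O (fun y => J y (X y))) ->
  open U -> smooth_along f U V -> smooth_along f U (fun y => J (f y) (V y)).
Proof.
move=> sJ oU sV; apply: smooth_along_local => x Ux.
exists (chart_nbhs f U x); split; first exact: chart_nbhs_self.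
have oB := open_chart_nbhs hf x oU.
have oC : open (cdom (chart_at (f x))) := @cdom_open _ _ _ _.
have sE i := sJ _ _ oC (smooth_coord_field (f x) i).
have H : smooth_along f (chart_nbhs f U x) (fun y => \sum_(i < n)
    (along_coef f x V i y : R) *: J (f y) (coord_field (f x) i (f y))).
  apply: smooth_along_sum => // i; apply: smooth_along_scale => //.
    exact: smooth_along_coef.
  by apply: smooth_along_sub (smooth_along_comp hf oC (sE i)) => y [].
apply: (smooth_along_ext hf oB _ H) => y By.
rewrite -(along_coefE V By) linear_sum; apply: eq_bigr => i _.
by rewrite linearZ.
Qed.

(** [J] is linear over functions, so it commutes with the Leibniz rule; on the
    coordinate fields it commutes with the ambient connection. *)
Lemma pullback_parallel (J : N -> 'End('rV[R]_n)) U V x v :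
  (forall O X, open O -> smooth_vfield O X -> smooth_vfield O (fun y => J y (X y))) ->
  (forall O Y y w, open O -> smooth_vfield O Y -> O y ->
      nablaN (fun z => J z (Y z)) y w = J y (nablaN Y y w)) ->
  open U -> U x -> smooth_along f U V ->
  D (fun y => J (f y) (V y)) x v = J (f x) (D V x v).
Proof.
move=> sJ pJ oU Ux sV; have [cD eD] := hD.
have oB := open_chart_nbhs hf x oU.
have Bx := chart_nbhs_self f Ux.
have oC : open (cdom (chart_at (f x))) := @cdom_open _ _ _ _.
have Cx : cdom (chart_at (f x)) (f x) := cdom_chart_at _.
have sE i := smooth_coord_field (f x) i.
have sJE i := sJ _ _ oC (sE i).
have sJV := smooth_along_sub (@chart_nbhs_sub _ _ _ _ _ f U x)
  (smooth_along_endo sJ oU sV).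
have -> : D (fun y => J (f y) (V y)) x v = D (fun y => \sum_(i < n)
    (along_coef f x V i y : R) *: J (f y) (coord_field (f x) i (f y))) x v.
  apply: (connection_local cD _ oB sJV _ Bx) => y By.
  rewrite -[in LHS](along_coefE V By) linear_sum; apply: eq_bigr => i _.
  by rewrite linearZ.
rewrite (pullback_sum hf hD (Z := fun i p => J p (coord_field (f x) i p)) v
  oB Bx oC Cx _ sJE); last by move=> i; exact: smooth_along_coef.
rewrite (pullbackE hf hD _ oU Ux sV) linear_sum; apply: eq_bigr => i _.
by rewrite linearD !linearZ /= (pJ _ _ _ _ oC (sE i) Cx).
Qed.

End PullbackLeviCivita.

(** * Local orthonormal frames *)

Section OrthonormalBasis.
Context {R : realType} {n : nat}.

(** With [E] the matrix of rows [e i], orthonormality says [E A E^T = 1]; a one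
    sided inverse of a square matrix is two sided, so [A E^T E = 1]. *)
Lemma orthonormal_expand (A : 'M[R]_n) (e : 'I_n -> 'rV[R]_n) (w : 'rV[R]_n) :
  (forall i j, bil A (e i) (e j) = (i == j)%:R) ->
  w = \sum_(i < n) bil A w (e i) *: e i.
Proof.
move=> orth; pose E := \matrix_(i < n) e i.
have EA : E *m (A *m E^T) = 1%:M.
  apply/matrixP => i j; rewrite !mxE -orth /bil -mulmxA mxE.
  apply: eq_bigr => k _; rewrite !mxE; congr (_ * _).
  by apply: eq_bigr => l _; rewrite !mxE.
have AE := mulmx1C EA.
rewrite -[LHS]mulmx1 -AE mulmxA [LHS]mulmx_sum_row; apply: eq_bigr => i _.
rewrite rowK; congr (_ *: _); rewrite /bil mulmxA [LHS]mxE [RHS]mxE.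
by apply: eq_bigr => k _; rewrite !mxE.
Qed.

Lemma exists_not_lincomb j (e : 'I_j -> 'rV[R]_n) : (j < n)%N ->
  exists w : 'rV[R]_n, forall a : 'I_j -> R, w != \sum_(i < j) a i *: e i.
Proof.
move=> jn; pose E := \matrix_(i < j) e i.
have nfull : ~~ row_full E.
  by rewrite /row_full neq_ltn (leq_ltn_trans (rank_leq_row E)).
have /row_subPn[i niE] : ~~ (1%:M <= E)%MS by rewrite sub1mx.
exists (row i 1%:M) => a; apply: contraNneq niE => ->.
apply: summx_sub => k _; apply: scalemx_sub.
by rewrite -[e k](rowK e); exact: row_sub.
Qed.

End OrthonormalBasis.

Section Frames.
Context {R : realType} {m n : nat} {M : manifold R m} {N : manifold R n}.
Variables (f : M -> N) (hf : smooth_map f).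
Variables (gN : N -> 'M[R]_n) (hgN : riemannian_metric gN).
Implicit Types (U : set M) (e : nat -> M -> 'rV[R]_n).

(** Families are indexed by [nat], with a bound, so that extending a family does
    not change the type of its index. *)
Definition orthonormal_along U (j : nat) e :=
  (forall i, (i < j)%N -> smooth_along f U (e i)) /\
  (forall y i k, U y -> (i < j)%N -> (k < j)%N ->
    bil (gN (f y)) (e i y) (e k y) = (i == k)%:R).

Lemma open_positive U (h : M -> R^o) : open U -> smooth_fun U h ->
  open (U `&` [set y | 0 < (h y : R)]).
Proof.
move=> oU sh; rewrite openE => y [Uy hy].
apply: filterI; first exact: open_nbhs_nbhs.
have /= ch := smooth_fun_continuous oU Uy sh.
apply: (ch [set t | 0 < (t : R)]).
by apply: open_nbhs_nbhs; split => //; exact: open_gt.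
Qed.

(** One step of the Gram-Schmidt process, started from a vector at [x] outside
    the span of the family; its residual stays nonzero near [x]. *)
Lemma orthonormal_extend1 U x j e : open U -> U x -> (j < n)%N ->
  orthonormal_along U j e ->
  exists U' e', [/\ open U', U' x, U' `<=` U,
    orthonormal_along U' j.+1 e' & forall i, (i < j)%N -> e' i = e i].
Proof.
move=> oU Ux jn [se oe].
have [w wP] := exists_not_lincomb (fun i : 'I_j => e i x) jn.
pose C := chart_at (f x).
have CA : atlas N C := atlas_chart_at _.
have Cx : cdom C (f x) := cdom_chart_at _.
pose W y := tvec C (f y) (tcoord C (f x) w).
have Wx : W x = w by rewrite /W tcoordK.
pose U1 := chart_nbhs f U x.
have oU1 : open U1 := open_chart_nbhs hf x oU.
have U1x : U1 x := chart_nbhs_self f Ux.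
have sW : smooth_along f U1 W.
  apply: (smooth_along_sub _ (smooth_along_comp hf (@cdom_open _ _ _ C)
    (smooth_tvec (tcoord C (f x) w) CA))).
  by move=> y [].
have se1 i : (i < j)%N -> smooth_along f U1 (e i).
  by move=> ij; apply: smooth_along_sub (se i ij); exact: chart_nbhs_sub.
pose Z y := W y + \sum_(i < j) (- bil (gN (f y)) (W y) (e i y)) *: e i y.
have sZ : smooth_along f U1 Z.
  apply: smooth_along_add => //; apply: smooth_along_sum => // i.
  apply: (smooth_along_scale (h := fun y => - bil (gN (f y)) (W y) (e i y) : R^o) hf oU1);
    last exact: se1.
  have s1 := smooth_fun_mul oU1 (smooth_fun_cst U1 (-1 : R^o))
    (smooth_gram hf hgN oU1 sW (se1 i (ltn_ord i))).
  by apply: smooth_fun_ext s1 => // y _; rewrite mulN1r.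
pose h y : R^o := bil (gN (f y)) (Z y) (Z y).
have sh : smooth_fun U1 h := smooth_gram hf hgN oU1 sZ sZ.
have hx : 0 < (h x : R).
  apply: (metric_pos hgN); have := wP (fun i => bil (gN (f x)) (W x) (e i x)).
  apply: contraNneq => /eqP; rewrite /Z.
  under eq_bigr do rewrite scaleNr.
  by rewrite sumrN subr_eq0 Wx.
pose U2 := U1 `&` [set y | 0 < (h y : R)].
have oU2 : open U2 := open_positive oU1 sh.
have U2U : U2 `<=` U by move=> y [/chart_nbhs_sub].
have Ze y k : U1 y -> (k < j)%N -> bil (gN (f y)) (Z y) (e k y) = 0.
  move=> [Uy _] kj; rewrite /Z bilDl bil_suml (bigD1 (Ordinal kj)) //= big1 => [|i ik].
    by rewrite bilZl oe// eqxx mulr1 addr0 subrr.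
  rewrite bilZl oe// (_ : (i == k :> nat) = false) ?mulr0//.
  by apply/negbTE; apply: contra ik => /eqP ik; apply/eqP/val_inj.
(* dividing by the norm, as a real power of the squared norm *)
pose nu y := ((h y : R) `^ (- 2^-1)) *: Z y.
have snu : smooth_along f U2 nu.
  apply: (smooth_along_scale (h := fun y => (h y : R) `^ (- 2^-1) : R^o) hf oU2).
    apply: smooth_fun_powR => // [y []//|].
    by apply: smooth_fun_sub sh => y [].
  by apply: smooth_along_sub sZ => y [].
have nunu y : U2 y -> bil (gN (f y)) (nu y) (nu y) = 1.
  move=> [_ hy]; rewrite /nu bilZl bilZr -/(h y) mulrA -powRD; last first.
    by rewrite (gt_eqF hy) implybT.
  have -> : - 2^-1 - 2^-1 = -1 :> R by rewrite -opprD -[2^-1]mul1r -splitr.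
  by rewrite powR_inv1 ?ltW// mulVf// gt_eqF.
have nue y k : U2 y -> (k < j)%N -> bil (gN (f y)) (nu y) (e k y) = 0.
  by move=> [U1y _] kj; rewrite /nu bilZl Ze// mulr0.
exists U2, (fun i => if (i < j)%N then e i else nu); split => //.
- split=> [i|y i k U2y].
    rewrite ltnS leq_eqVlt; case: ltnP => [ij _|_ _]; last exact: snu.
    exact: smooth_along_sub U2U (se i ij).
  rewrite !ltnS => ij kj; case: ltnP => [ij'|ji]; case: ltnP => [kj'|jk].
  + by rewrite oe//; exact: U2U.
  + rewrite (Defs.metric_sym hgN) nue// (_ : i == k = false)//.
    by apply/negbTE; rewrite neq_ltn (leq_trans ij' jk).
  + rewrite nue// (_ : i == k = false)//.
    by apply/negbTE; rewrite neq_ltn (leq_trans kj' ji) orbT.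
  + rewrite nunu// (_ : i == k)//.
    by rewrite eqn_leq (leq_trans ij jk) (leq_trans kj ji).
- by move=> i ->.
Qed.

(** Completes any orthonormal family to a frame.  It gives tangent frames when
    [f] is the identity and the family is empty, and normal frames when the
    family is the image of a tangent frame. *)
Lemma orthonormal_extend U x j e : open U -> U x -> (j <= n)%N ->
  orthonormal_along U j e ->
  exists U' e', [/\ open U', U' x, U' `<=` U,
    orthonormal_along U' n e' & forall i, (i < j)%N -> e' i = e i].
Proof.
move=> oU Ux jn he.
have [d {}jn] : exists d, (d + j)%N = n by exists (n - j)%N; rewrite subnK.
elim: d j jn U e oU Ux he => [|d IH] j jn U e oU Ux he.
  by rewrite add0n in jn; exists U, e; split => //; rewrite -jn.
have jn' : (j < n)%N by rewrite -jn addSn ltnS leq_addl.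
have [U1 [e1 [oU1 U1x U1U he1 e1e]]] := orthonormal_extend1 oU Ux jn' he.
have jn1 : (d + j.+1)%N = n by rewrite addnS -addSn.
have [U2 [e2 [oU2 U2x U2U he2 e2e]]] := IH _ jn1 _ _ oU1 U1x he1.
exists U2, e2; split => //; first exact: subset_trans U1U.
by move=> i ij; rewrite e2e ?e1e// ltnS ltnW.
Qed.

End Frames.

(** * Isometric immersions and the Gauss formula *)

Section Immersion.
Context {R : realType} {m n : nat} {M : manifold R m} {N : manifold R n}.
Variables (f : M -> N) (gN : N -> 'M[R]_n) (g : M -> 'M[R]_m).
Hypotheses (hgN : riemannian_metric gN) (hI : isometric_immersion f gN g).
Implicit Types (U : set M) (x : M) (v : 'rV[R]_m) (w : 'rV[R]_n).

Lemma immersion_smooth : smooth_map f. Proof. by have [] := hI. Qed.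

Lemma immersion_metric : riemannian_metric g. Proof. by have [] := hI. Qed.

Lemma dmap_isometry x u v :
  bil (gN (f x)) (dmap f x u) (dmap f x v) = bil (g x) u v.
Proof. by have [_ _ _] := hI; apply. Qed.

Lemma dmapB x u v : dmap f x (u - v) = dmap f x u - dmap f x v.
Proof. exact: tdiffB. Qed.

Lemma dmapP x (a : R) u v :
  dmap f x (a *: u + v) = a *: dmap f x u + dmap f x v.
Proof. exact: tdiffP. Qed.

Lemma dmap_sum x p (a : 'I_p -> R) (v : 'I_p -> 'rV[R]_m) :
  dmap f x (\sum_(i < p) a i *: v i) = \sum_(i < p) a i *: dmap f x (v i).
Proof.
rewrite /dmap /tdiff linear_sum; apply: eq_bigr => i _.
by rewrite linearZ.
Qed.

Lemma bil_nondegenerate x u : (forall v, bil (g x) u v = 0) -> u = 0.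
Proof.
move=> u0; apply: contraTeq (lexx (0 : R)) => /(metric_pos immersion_metric x).
by rewrite u0 ltxx.
Qed.

Lemma vfield_through x v : exists U X,
  [/\ open U, U x, smooth_vfield U X & X x = v].
Proof.
exists (cdom (chart_at x)), (fun y => tvec (chart_at x) y v); split.
- exact: cdom_open.
- exact: cdom_chart_at.
- exact/smooth_tvec/atlas_chart_at.
- by rewrite /tvec diff_chart_id//; exact: cdom_chart_at.
Qed.

Lemma tangent_frame x : exists U e,
  [/\ open U, U x & orthonormal_along (fun y : M => y) g U m e].
Proof.
have [] := @orthonormal_extend _ _ _ _ _ (fun y : M => y) smooth_map_id g
  immersion_metric setT x 0 (fun _ _ => 0) openT I (leq0n _).
  by split=> [i|y i k _]; rewrite ltn0.
by move=> U [e [oU Ux _ he _]]; exists U, e.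
Qed.

(** An explicit tangential part.  It serves both for the existence of tangential
    parts and for their smoothness, since for a smooth frame and a smooth
    section [w] it varies smoothly with the point. *)
Lemma orthonormal_frame_dec x (e : 'I_m -> 'rV[R]_m) w :
  (forall i j, bil (g x) (e i) (e j) = (i == j)%:R) ->
  is_normal f gN x (w - dmap f x (\sum_(i < m)
    bil (gN (f x)) w (dmap f x (e i)) *: e i)).
Proof.
move=> oe u; rewrite bilBl dmap_sum bil_suml.
rewrite {1}(orthonormal_expand u oe) dmap_sum bil_sumr.
apply/eqP; rewrite subr_eq0; apply/eqP; apply: eq_bigr => i _.
by rewrite bilZl bilZr dmap_isometry (Defs.metric_sym immersion_metric) mulrC.
Qed.

Lemma tangential_is_normal x w : is_normal f gN x (w - dmap f x (tangential f gN x w)).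
Proof.
have [U [e [_ Ux [_ oe]]]] := tangent_frame x.
have oex (i j : 'I_m) : bil (g x) (e i x) (e j x) = (i == j)%:R.
  by rewrite oe.
have H := orthonormal_frame_dec w oex.
exact: (xgetI 0 (H : [set v | is_normal f gN x (w - dmap f x v)] _)).
Qed.

Lemma bil_tangential x w u :
  bil (g x) (tangential f gN x w) u = bil (gN (f x)) w (dmap f x u).
Proof.
have := tangential_is_normal x w u.
by rewrite bilBl dmap_isometry => /eqP; rewrite subr_eq0 => /eqP.
Qed.

Lemma tangential_unique x w v : is_normal f gN x (w - dmap f x v) ->
  tangential f gN x w = v.
Proof.
move=> nv; apply/eqP; rewrite -subr_eq0; apply/eqP.
apply: (@bil_nondegenerate x) => u; rewrite bilBl bil_tangential.
by have := nv u; rewrite bilBl dmap_isometry.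
Qed.

Lemma tangentialP x (a : R) w w' :
  tangential f gN x (a *: w + w') = a *: tangential f gN x w + tangential f gN x w'.
Proof.
apply: tangential_unique => u.
by rewrite dmapP bilBl !bilDl !bilZl !dmap_isometry !bil_tangential subrr.
Qed.

Lemma tangentialB x w w' :
  tangential f gN x (w - w') = tangential f gN x w - tangential f gN x w'.
Proof. by rewrite addrC -scaleN1r tangentialP scaleN1r addrC. Qed.

Lemma tangentialD x w w' :
  tangential f gN x (w + w') = tangential f gN x w + tangential f gN x w'.
Proof. by rewrite -[w]scale1r tangentialP !scale1r. Qed.

Lemma tangentialZ x (a : R) w :
  tangential f gN x (a *: w) = a *: tangential f gN x w.
Proof.
have t0 : tangential f gN x 0 = 0 by rewrite -(subrr w) tangentialB subrr.
by rewrite -[a *: w]addr0 tangentialP t0 addr0.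
Qed.

Lemma tangential_sum x p (w : 'I_p -> 'rV[R]_n) :
  tangential f gN x (\sum_(i < p) w i) = \sum_(i < p) tangential f gN x (w i).
Proof.
apply: (big_morph (tangential f gN x)); first exact: tangentialD.
by rewrite -[X in tangential f gN x X](subrr 0) tangentialB subrr.
Qed.

Lemma tangential_dmap x v : tangential f gN x (dmap f x v) = v.
Proof. by apply: tangential_unique => u; rewrite subrr bil0l. Qed.

Lemma tangential_normal x w : is_normal f gN x w -> tangential f gN x w = 0.
Proof.
move=> nw; apply: (@bil_nondegenerate x) => u.
by rewrite bil_tangential.
Qed.

Lemma smooth_tangential U V : open U -> smooth_along f U V ->
  smooth_vfield U (fun y => tangential f gN y (V y)).
Proof.
move=> oU sV; apply: smooth_along_local => x Ux.
have [B [e [oB Bx [se oe]]]] := tangent_frame x.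
exists (B `&` U); split => //.
have oBU : open (B `&` U) by exact: openI.
have sV' : smooth_along f (B `&` U) V by apply: smooth_along_sub sV => y [].
have se' (i : 'I_m) : smooth_vfield (B `&` U) (e i).
  by apply: smooth_along_sub (se i (ltn_ord i)) => y [].
have H : smooth_vfield (B `&` U) (fun y => \sum_(i < m)
    (bil (gN (f y)) (V y) (dmap f y (e i y)) : R) *: e i y).
  apply: (smooth_along_sum (@smooth_map_id _ _ M)) => // i.
  apply: (smooth_along_scale (@smooth_map_id _ _ M)) => //; last exact: se'.
  apply: (smooth_gram immersion_smooth hgN) => //.
  exact: (smooth_along_dmap immersion_smooth).
apply: (smooth_along_ext (@smooth_map_id _ _ M) _ _ H) => // y [By Uy].
symmetry; apply: tangential_unique; apply: orthonormal_frame_dec => i j.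
by rewrite oe.
Qed.

Variables (nablaN : (N -> 'rV[R]_n) -> N -> 'rV[R]_n -> 'rV[R]_n)
  (D : (M -> 'rV[R]_n) -> M -> 'rV[R]_m -> 'rV[R]_n)
  (nabla : (M -> 'rV[R]_m) -> M -> 'rV[R]_m -> 'rV[R]_m).
Hypotheses (hN : levi_civita gN nablaN) (hD : pullback_connection f nablaN D)
  (hM : levi_civita g nabla).

(** Both sides are torsion-free and metric, so their difference [B] satisfies
    that [g (B X Y) Z] is symmetric in [X], [Y] and skew in [Y], [Z]; a trilinear
    expression with these two symmetries vanishes. *)
Lemma gauss_formula U x (Y : M -> 'rV[R]_m) v : open U -> U x -> smooth_vfield U Y ->
  tangential f gN x (D (fun y => dmap f y (Y y)) x v) = nabla Y x v.
Proof.
move=> oU Ux sY; have hf := immersion_smooth.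
have [UX [X [oUX UXx sX Xv]]] := vfield_through x v; rewrite -{}Xv.
apply/eqP; rewrite -subr_eq0; apply/eqP; apply: (@bil_nondegenerate x) => w.
have [UZ [Z [oUZ UZx sZ Zw]]] := vfield_through x w; rewrite -{}Zw.
pose B := U `&` UX `&` UZ.
have oB : open B by apply: openI => //; exact: openI.
have Bx : B x by [].
have {}sX : smooth_vfield B X by apply: smooth_along_sub sX => y [[]].
have {}sY : smooth_vfield B Y by apply: smooth_along_sub sY => y [[]].
have {}sZ : smooth_vfield B Z by apply: smooth_along_sub sZ => y [].
pose d (P Q : M -> 'rV[R]_m) :=
  tangential f gN x (D (fun y => dmap f y (Q y)) x (P x)) - nabla Q x (P x).
pose b P Q S := bil (g x) (d P Q) (S x).
have symb P Q S : smooth_vfield B P -> smooth_vfield B Q -> b P Q S = b Q P S.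
  move=> sP sQ; rewrite /b; congr (bil _ _ _).
  have T : tangential f gN x (D (fun y => dmap f y (Q y)) x (P x)) -
      tangential f gN x (D (fun y => dmap f y (P y)) x (Q x)) =
      nabla Q x (P x) - nabla P x (Q x).
    rewrite -tangentialB (pullback_torsion_free hf hN hD oB Bx sP sQ).
    by rewrite tangential_dmap (lc_torsion_free hM oB sP sQ Bx).
  apply/eqP; rewrite /d subr_eq -addrA [X in _ == _ + X]addrC -T addrC.
  by rewrite subrK.
have skewb P Q S : smooth_vfield B P -> smooth_vfield B Q -> smooth_vfield B S ->
    b P Q S = - b P S Q.
  move=> sP sQ sS; rewrite /b /d !bilBl !bil_tangential.
  have := pullback_metric hf hgN hN hD (P x) oB Bx (smooth_along_dmap hf oB sQ)
    (smooth_along_dmap hf oB sS).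
  rewrite /compatible_at; under [fun y => _]eq_fun do rewrite dmap_isometry.
  rewrite (lc_metric hM (P x) oB sQ sS Bx) => /eqP.
  rewrite (Defs.metric_sym immersion_metric x (Q x)).
  rewrite (Defs.metric_sym hgN (f x) (dmap f x (Q x))) => /eqP E.
  apply/eqP; rewrite opprB subr_eq addrAC eq_sym subr_eq.
  by rewrite addrC E.
have H : b X Y Z = - b X Y Z.
  rewrite {1}(skewb _ _ _ sX sY sZ) (symb _ _ _ sX sZ) (skewb _ _ _ sZ sX sY).
  by rewrite (symb _ _ _ sZ sY) (skewb _ _ _ sY sZ sX) (symb _ _ _ sY sX) !opprK.
apply/eqP; move/eqP: H; rewrite -subr_eq0 opprK -mulr2n.
by rewrite mulrn_eq0.
Qed.

End Immersion.

(** * Normal frames *)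

Section NormalFrame.
Context {R : realType} {m r : nat} {M : manifold R m} {N : manifold R (m + r)}.
Variables (f : M -> N) (gN : N -> 'M[R]_(m + r)) (g : M -> 'M[R]_m).
Variable J : N -> 'End('rV[R]_(m + r)).
Hypotheses (hgN : riemannian_metric gN) (hI : isometric_immersion f gN g).
Implicit Types (U : set M) (x : M) (v : 'rV[R]_m).

Lemma Npart_is_normal x v : is_normal f gN x (Npart f gN J x v).
Proof. exact: (tangential_is_normal hI). Qed.

(** An orthonormal tangent frame, pushed forward by [f], is completed to an
    orthonormal frame of [f^* TN]; the [r] new members are normal, and the
    forms [u] are the components of [Npart] on them. *)
Lemma exists_normal_frame U x : open U -> U x ->
  exists B (nu : 'I_r -> M -> 'rV[R]_(m + r)) (u : 'I_r -> M -> 'rV[R]_m -> R^o),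
    [/\ open B, B x, B `<=` U, normal_frame f gN B nu & normal_forms f gN J B nu u].
Proof.
move=> oU Ux; have hf := immersion_smooth hI.
have [B1 [e [oB1 B1x [se oe]]]] := tangent_frame hI x.
have oB1U : open (B1 `&` U) by exact: openI.
have [||||B2 [e' [oB2 B2x B2B [se' oe'] e'e]]] :=
  @orthonormal_extend _ _ _ _ _ f hf gN hgN (B1 `&` U) x m
    (fun i y => dmap f y (e i y)) => //; first exact: leq_addr.
  split=> [i im|y i k [By Uy] im km].
    apply: (smooth_along_dmap hf oB1U).
    by apply: smooth_along_sub (se i im) => y [].
  by rewrite (dmap_isometry hI) oe.
pose nu (a : 'I_r) := e' (m + a)%N.
have nuN (a : 'I_r) y : B2 y -> is_normal f gN y (nu a y).
  move=> B2y v; have [B1y _] := B2B _ B2y.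
  have oey (i j : 'I_m) : bil (g y) (e i y) (e j y) = (i == j)%:R by rewrite oe.
  rewrite (orthonormal_expand v oey) (dmap_sum f) bil_sumr big1// => i _.
  have -> : dmap f y (e i y) = e' i y by rewrite e'e.
  (* the frame is orthonormal, and the first [m] members are the tangential ones *)
  rewrite bilZr oe' ?ltn_add2l ?(ltn_addr _ (ltn_ord i))//.
  by rewrite gtn_eqF ?mulr0// (leq_trans (ltn_ord i))// leq_addr.
exists B2, nu, (fun a y v => bil (gN (f y)) (Npart f gN J y v) (nu a y)); split => //.
- by move=> y /B2B[].
- split => //.
  + by move=> a; apply: se'; rewrite ltn_add2l.
  + by move=> a b y By; rewrite oe' ?ltn_add2l// eqn_add2l.
- move=> y v By.
  have oey (i j : 'I_(m + r)) : bil (gN (f y)) (e' i y) (e' j y) = (i == j)%:R.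
    by rewrite oe'.
  rewrite {1}(orthonormal_expand (Npart f gN J y v) oey) big_split_ord /=.
  rewrite big1 ?add0r// => i _.
  have -> : e' i y = dmap f y (e i y) by rewrite e'e.
  by rewrite Npart_is_normal scale0r.
Qed.

Section Forms.
Variables (U : set M) (nu : 'I_r -> M -> 'rV[R]_(m + r))
  (u : 'I_r -> M -> 'rV[R]_m -> R^o).
Hypotheses (hnu : normal_frame f gN U nu) (hu : normal_forms f gN J U nu u).

(** The forms are determined by the frame.  Since [J X] and its normal part have
    the same pairing with a normal vector, no projection occurs here, and the
    smoothness of [u_a(X)] follows at once. *)
Lemma normal_formE a x v : U x ->
  u a x v = bil (gN (f x)) (J (f x) (dmap f x v)) (nu a x) :> R.
Proof.
move=> Ux; have [_ nuN onu] := hnu.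
have -> : J (f x) (dmap f x v) = Npart f gN J x v + dmap f x (Tpart f gN J x v).
  by rewrite subrK.
rewrite bilDl [X in _ = _ + X](Defs.metric_sym hgN) nuN// addr0.
rewrite (hu v Ux) bil_suml (bigD1 a) //= big1 => [|b ba].
  by rewrite bilZl onu// eqxx mulr1 addr0.
by rewrite bilZl onu// (negbTE ba) mulr0.
Qed.

Lemma normal_formB a x v w : U x -> u a x (v - w) = u a x v - u a x w :> R.
Proof. by move=> Ux; rewrite !normal_formE// (dmapB f) linearB bilBl. Qed.

Lemma normal_decomposition x v : U x ->
  J (f x) (dmap f x v) =
  dmap f x (Tpart f gN J x v) + \sum_(a < r) (u a x v : R) *: nu a x.
Proof. by move=> Ux; rewrite -(hu v Ux) addrC subrK. Qed.

End Forms.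
End NormalFrame.

(** * Pointwise algebra of semi-slant submanifolds *)

Section SemiSlant.
Context {R : realType} {p q m n : nat} {M : manifold R m} {N : manifold R n}.
Variables (f : M -> N) (gN : N -> 'M[R]_n) (g : M -> 'M[R]_m).
Variable J : N -> 'End('rV[R]_n).
Hypotheses (hq : (0 < q)%N) (hJ : metallic p q gN J)
  (hI : isometric_immersion f gN g).
Variables (D1 D2 : M -> {vspace 'rV[R]_m}) (theta : R).
Hypothesis hD : semi_slant f gN J g D1 D2 theta.
Implicit Types (x : M) (v w : 'rV[R]_m).

Let hgN := metallic_metric hJ.

(** [J^2 = p J + q] with [q] nonzero. *)
Lemma metallic_injective y (w : 'rV[R]_n) : J y w = 0 -> w = 0.
Proof.
move=> Jw; have := metallic_eq hJ y w; rewrite Jw linear0 scaler0 add0r.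
move/esym/eqP; rewrite scaler_eq0 pnatr_eq0 => /orP[/eqP q0|/eqP//].
by move: hq; rewrite q0.
Qed.

Lemma dmap_injective x v : dmap f x v = 0 -> v = 0.
Proof.
have [_ _ inj _] := hI => v0; apply: (inj x).
by rewrite v0 /dmap /tdiff linear0.
Qed.

Lemma TpartB x v w :
  Tpart f gN J x (v - w) = Tpart f gN J x v - Tpart f gN J x w.
Proof. by rewrite /Tpart (dmapB f) linearB (tangentialB hI). Qed.

Lemma TpartD x v w :
  Tpart f gN J x (v + w) = Tpart f gN J x v + Tpart f gN J x w.
Proof. by rewrite /Tpart /dmap /tdiff !linearD (tangentialD hI). Qed.

(** [J X] is the image of a vector of [D1], which can only be [T X]. *)
Lemma J_dmap_D1 x v : v \in D1 x ->
  J (f x) (dmap f x v) = dmap f x (Tpart f gN J x v) /\ Tpart f gN J x v \in D1 x.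
Proof.
move=> vD; have : [set J (f x) (dmap f x v) | v in [set` D1 x]] (J (f x) (dmap f x v)).
  by exists v.
rewrite (semi_slant_invariant hD) => -[w wD wE].
by rewrite /Tpart -wE (tangential_dmap hI).
Qed.

Lemma semi_slant_dec x v : exists2 v1, v1 \in D1 x & exists2 v2, v2 \in D2 x & v = v1 + v2.
Proof. by apply/memv_addP; rewrite (semi_slant_sum hD) memvf. Qed.

(** [D2] is the whole orthogonal complement of [D1], because they are orthogonal
    and span. *)
Lemma orthogonal_D1 x v : (forall w, w \in D1 x -> bil (g x) v w = 0) -> v \in D2 x.
Proof.
have [v1 v1D [v2 v2D ->]] := semi_slant_dec x v => orth.
suff -> : v1 = 0 by rewrite add0r.
apply: contraTeq (lexx (0 : R)) => /(metric_pos (immersion_metric hI) x).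
have := orth _ v1D; rewrite bilDl [X in _ + X](Defs.metric_sym (immersion_metric hI)).
by rewrite (semi_slant_orth hD v1D v2D) addr0 => ->; rewrite ltxx.
Qed.

(** [T] is symmetric and preserves [D1], hence preserves its orthogonal
    complement. *)
Lemma Tpart_D2 x v : v \in D2 x -> Tpart f gN J x v \in D2 x.
Proof.
move=> vD; apply: orthogonal_D1 => w wD; rewrite (bil_tangential hI).
rewrite (metallic_sym hJ); have [-> TD] := J_dmap_D1 wD.
rewrite (dmap_isometry hI) (Defs.metric_sym (immersion_metric hI)).
exact: (semi_slant_orth hD TD vD).
Qed.

(** Where [J] maps a vector of [D2] to a tangent vector, that image lies in
    [D2]: its angle with [D2] is [0], against [theta != 0]. *)
Lemma Npart_eq0 x v : Npart f gN J x v = 0 -> v \in D1 x.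
Proof.
have [v1 v1D [v2 v2D vE]] := semi_slant_dec x v => N0.
suff v20 : v2 = 0 by rewrite vE v20 addr0.
apply/eqP; apply/negPn/negP => v2N0.
have JE : J (f x) (dmap f x v2) = dmap f x (Tpart f gN J x v2).
  have JvE : J (f x) (dmap f x v) = dmap f x (Tpart f gN J x v).
    by apply/eqP; rewrite -subr_eq0; apply/eqP.
  have -> : v2 = v - v1 by rewrite vE addrC addKr.
  rewrite TpartB !(dmapB f) linearB /= JvE.
  by have [<- _] := J_dmap_D1 v1D.
have [s [[s0 s0D <-] sorth thetaE]] := semi_slant_angle hD v2D v2N0.
(* a vector of [D2] is its own orthogonal projection on [D2] *)
have E : J (f x) (dmap f x v2) = dmap f x s0.
  rewrite JE; congr (dmap f x _); apply/eqP; rewrite -subr_eq0.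
  apply: contraTT (lexx (0 : R)) => /(metric_pos (immersion_metric hI) x).
  rewrite -ltNge; set d := _ - s0 => d0.
  have dD : d \in D2 x by apply: memvB => //; exact: Tpart_D2.
  have := sorth (dmap f x d); rewrite JE -(dmapB f) (dmap_isometry hI) -/d => dd.
  by rewrite dd ?ltxx// in d0; exists d.
have w0 : 0 < bil (gN (f x)) (J (f x) (dmap f x v2)) (J (f x) (dmap f x v2)).
  apply: (metric_pos hgN); apply/eqP => /metallic_injective/dmap_injective v20.
  by rewrite v20 eqxx in v2N0.
have := semi_slant_theta hD.
by rewrite thetaE -E divff ?acos1 ?eqxx// sqrtr_eq0 -ltNge.
Qed.

Lemma proj1_eq0 x v : (daddv_pi (D1 x) (D2 x) v = 0) <-> v \in D2 x.
Proof.
have d := semi_slant_direct hD x.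
have d' : (D2 x :&: D1 x = 0)%VS by rewrite capvC.
have vE : daddv_pi (D1 x) (D2 x) v + daddv_pi (D2 x) (D1 x) v = v.
  by apply: daddv_pi_add; rewrite // (semi_slant_sum hD) memvf.
split=> [v0|vD]; first by rewrite -vE v0 add0r memv_pi.
by move: vE; rewrite (daddv_pi_id d' vD) => /esym/eqP; rewrite -subr_eq subrr => /eqP.
Qed.

(** [T] preserves [D1] and [D2], so it commutes with the projection to [D1]; and
    on [D1] it is [J], which is injective. *)
Lemma proj1_Tpart_eq0 x v :
  daddv_pi (D1 x) (D2 x) (Tpart f gN J x v) = 0 <-> v \in D2 x.
Proof.
split=> [/proj1_eq0|/Tpart_D2/proj1_eq0//].
have [v1 v1D [v2 v2D ->]] := semi_slant_dec x v; rewrite TpartD => TD2.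
suff -> : v1 = 0 by rewrite add0r.
have [JE TD1] := J_dmap_D1 v1D.
have {}TD2 : Tpart f gN J x v1 \in D2 x.
  by rewrite -(addrK (Tpart f gN J x v2) (Tpart f gN J x v1)) memvB// Tpart_D2.
have T0 : Tpart f gN J x v1 = 0.
  apply/eqP; rewrite -memv0 -(semi_slant_direct hD x).
  by rewrite memv_cap TD1.
apply: (@dmap_injective x); apply: (@metallic_injective (f x)).
by rewrite JE T0 /dmap /tdiff linear0.
Qed.

End SemiSlant.

(** * The bracket of two sections *)

Section Integrability.
Context {R : realType} {p q m r : nat}.
Context {Mbar : manifold R (m + r)} {M : manifold R m}.
Variables (gbar : Mbar -> 'M[R]_(m + r)) (J : Mbar -> 'End('rV[R]_(m + r))).
Variables (nablabar : (Mbar -> 'rV[R]_(m + r)) -> Mbar -> 'rV[R]_(m + r) ->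
  'rV[R]_(m + r)).
Variables (g : M -> 'M[R]_m) (f : M -> Mbar).
Variables (nabla : (M -> 'rV[R]_m) -> M -> 'rV[R]_m -> 'rV[R]_m).
Variables (nablaf : (M -> 'rV[R]_(m + r)) -> M -> 'rV[R]_m -> 'rV[R]_(m + r)).
Hypotheses (hMbar : locally_metallic p q gbar J nablabar)
  (hf : isometric_immersion f gbar g) (hnabla : levi_civita g nabla)
  (hnablaf : pullback_connection f nablabar nablaf).
Implicit Types (U : set M) (x : M) (X Y : M -> 'rV[R]_m).

Let hJ : metallic p q gbar J. Proof. by have [] := hMbar. Qed.
Let hgbar := metallic_metric hJ.
Let hbar : levi_civita gbar nablabar. Proof. by have [] := hMbar. Qed.
Let sf := immersion_smooth hf.
Let idM := @smooth_map_id R m M.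

Lemma section_of_sub (D : M -> {vspace 'rV[R]_m}) U U' X : U' `<=` U ->
  section_of D U X -> section_of D U' X.
Proof.
move=> UU [sX XD]; split=> [|x /UU]; last exact: XD.
exact: smooth_along_sub UU sX.
Qed.

Section Forms.
Variables (U : set M) (nu : 'I_r -> M -> 'rV[R]_(m + r))
  (u : 'I_r -> M -> 'rV[R]_m -> R^o).
Hypotheses (oU : open U) (hnu : normal_frame f gbar U nu)
  (hu : normal_forms f gbar J U nu u).

Lemma smooth_normal_form a X : smooth_vfield U X ->
  smooth_fun U (fun y => u a y (X y)).
Proof.
move=> sX; have [snu _ _] := hnu.
have sJX := smooth_along_endo sf (metallic_smooth hJ) oU (smooth_along_dmap sf oU sX).
apply: smooth_fun_ext (smooth_gram sf hgbar oU sJX (snu a)) => // y Uy.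
by rewrite (normal_formE hgbar hnu hu).
Qed.

(** Weingarten's formula for the tangential part of the derivative of
    [J Y = T Y + sum_a u_a(Y) nu_a], where [J] is parallel. *)
Lemma tangential_J_derivative x Y v : U x -> smooth_vfield U Y ->
  tangential f gbar x (J (f x) (nablaf (fun y => dmap f y (Y y)) x v)) =
  nabla (fun y => Tpart f gbar J y (Y y)) x v -
  \sum_(a < r) (u a x (Y x) : R) *: shape_op f gbar nablaf (nu a) x v.
Proof.
move=> Ux sY; have [cD _] := hnablaf; have [snu nuN _] := hnu.
have [_ _ pJ] := hMbar.
have sdY := smooth_along_dmap sf oU sY.
have sJY := smooth_along_endo sf (metallic_smooth hJ) oU sdY.
have sTY : smooth_vfield U (fun y => Tpart f gbar J y (Y y)).
  exact: (smooth_tangential hgbar hf).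
have sdTY := smooth_along_dmap sf oU sTY.
have su a := smooth_normal_form a sY.
have sun a : smooth_along f U (fun y => (u a y (Y y) : R) *: nu a y).
  exact: smooth_along_scale.
have E : nablaf (fun y => J (f y) (dmap f y (Y y))) x v =
    nablaf (fun y => dmap f y (Tpart f gbar J y (Y y)) +
      \sum_(a < r) (u a y (Y y) : R) *: nu a y) x v.
  apply: (connection_local cD _ oU sJY _ Ux) => y Uy.
  exact: (normal_decomposition hu (Y y) Uy).
rewrite -(pullback_parallel sf hnablaf v (metallic_smooth hJ) _ oU Ux sdY); last first.
  by move=> B Z y w; exact: pJ.
rewrite E (connection_additive cD _ oU sdTY (smooth_along_sum sf oU sun) Ux).
rewrite (tangentialD hf) (gauss_formula hgbar hf hbar hnablaf hnabla _ oU Ux sTY).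
congr (_ + _); rewrite (connection_sum sf cD oU Ux _ sun) (tangential_sum hf).
rewrite -sumrN; apply: eq_bigr => a _.
rewrite (connection_leibniz cD _ oU (su a) (snu a) Ux).
rewrite (tangentialP hf) (tangential_normal hf (nuN a x Ux)) scaler0 add0r.
by rewrite (tangentialZ hf) /shape_op scalerN opprK.
Qed.

(** The difference of [tangential_J_derivative] for [X, Y] and [Y, X]: the left
    sides combine to [T (lie X Y)] because [D] is torsion-free. *)
Lemma Tpart_lie x X Y : U x -> smooth_vfield U X -> smooth_vfield U Y ->
  nabla (fun y => Tpart f gbar J y (Y y)) x (X x) -
  nabla (fun y => Tpart f gbar J y (X y)) x (Y x) =
  Tpart f gbar J x (lie X Y x) +
  \sum_(a < r) ((u a x (Y x) : R) *: shape_op f gbar nablaf (nu a) x (X x) -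
    (u a x (X x) : R) *: shape_op f gbar nablaf (nu a) x (Y x)).
Proof.
move=> Ux sX sY.
have -> : Tpart f gbar J x (lie X Y x) =
    tangential f gbar x (J (f x) (nablaf (fun y => dmap f y (Y y)) x (X x))) -
    tangential f gbar x (J (f x) (nablaf (fun y => dmap f y (X y)) x (Y x))).
  rewrite /Tpart -(pullback_torsion_free sf hbar hnablaf oU Ux sX sY) linearB.
  exact: (tangentialB hf).
rewrite !tangential_J_derivative// sumrB.
by rewrite addrACA subrK -opprD subrK.
Qed.

End Forms.

Variables (D1 D2 : M -> {vspace 'rV[R]_m}) (theta : R).
Hypothesis hD : semi_slant f gbar J g D1 D2 theta.

(** The forms vanish on sections of [D1], so only the terms [u_a (nabla_X Y)] of
    the covariant derivatives remain, and [nabla] is torsion-free. *)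
Lemma cov_form_D1 U nu (u : 'I_r -> M -> 'rV[R]_m -> R^o) X Y a x : open U -> U x ->
  normal_frame f gbar U nu -> normal_forms f gbar J U nu u ->
  section_of D1 U X -> section_of D1 U Y ->
  cov_form nabla (u a) X Y x - cov_form nabla (u a) Y X x = - u a x (lie X Y x) :> R.
Proof.
move=> oU Ux hnu hu [sX XD] [sY YD].
have u0 Z y : U y -> Z y \in D1 y -> u a y (Z y) = 0.
  move=> Uy ZD; rewrite (normal_formE hgbar hnu hu)//.
  have [-> _] := J_dmap_D1 hf hD ZD.
  by have [_ nuN _] := hnu; rewrite (Defs.metric_sym hgbar) nuN.
have d0 Z v : (forall y, U y -> Z y \in D1 y) -> tdiff (fun y => u a y (Z y)) x v = 0.
  move=> ZD; rewrite -(tdiff_ext (U := U) (h := fun _ => 0 : R^o)) ?tdiff_cst//.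
    exact: smooth_fun_cst.
  by move=> y Uy; rewrite u0// ZD.
rewrite /cov_form !d0// !sub0r -(lc_torsion_free hnabla oU sX sY Ux).
by rewrite (normal_formB hgbar hnu hu)// opprB opprK addrC.
Qed.

End Integrability.

Theorem theorem3 (R : realType) (p q m r : nat)
  (hp : (0 < p)%N) (hq : (0 < q)%N) (hm : (0 < m)%N) (hr : (0 < r)%N)
  (Mbar : manifold R (m + r)) (gbar : Mbar -> 'M[R]_(m + r))
  (J : Mbar -> 'End('rV[R]_(m + r)))
  (nablabar : (Mbar -> 'rV[R]_(m + r)) -> Mbar -> 'rV[R]_(m + r) ->
              'rV[R]_(m + r))
  (hMbar : locally_metallic p q gbar J nablabar)
  (M : manifold R m) (g : M -> 'M[R]_m)
  (f : M -> Mbar) (hf : isometric_immersion f gbar g)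
  (nabla : (M -> 'rV[R]_m) -> M -> 'rV[R]_m -> 'rV[R]_m)
  (hnabla : levi_civita g nabla)
  (nablaf : (M -> 'rV[R]_(m + r)) -> M -> 'rV[R]_m -> 'rV[R]_(m + r))
  (hnablaf : pullback_connection f nablabar nablaf)
  (D1 D2 : M -> {vspace 'rV[R]_m}) (theta : R)
  (hD : semi_slant f gbar J g D1 D2 theta) :
  (integrable_distribution D1 <->
   forall (U : set M) (nu : 'I_r -> M -> 'rV[R]_(m + r))
          (u : 'I_r -> M -> 'rV[R]_m -> R^o) (X Y : M -> 'rV[R]_m),
     open U -> normal_frame f gbar U nu -> normal_forms f gbar J U nu u ->
     section_of D1 U X -> section_of D1 U Y ->
     forall (a : 'I_r) (x : M), U x ->
       cov_form nabla (u a) Y X x = cov_form nabla (u a) X Y x)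
  /\
  (integrable_distribution D2 <->
   forall (U : set M) (nu : 'I_r -> M -> 'rV[R]_(m + r))
          (u : 'I_r -> M -> 'rV[R]_m -> R^o) (X Y : M -> 'rV[R]_m),
     open U -> normal_frame f gbar U nu -> normal_forms f gbar J U nu u ->
     section_of D2 U X -> section_of D2 U Y ->
     forall x : M, U x ->
       daddv_pi (D1 x) (D2 x)
         (nabla (fun y => Tpart f gbar J y (Y y)) x (X x) -
          nabla (fun y => Tpart f gbar J y (X y)) x (Y x)) =
       \sum_(a < r)
         (u a x (Y x) *:
            daddv_pi (D1 x) (D2 x) (shape_op f gbar nablaf (nu a) x (X x)) -
          u a x (X x) *:
            daddv_pi (D1 x) (D2 x) (shape_op f gbar nablaf (nu a) x (Y x)))).
Proof.
have [hJ hbar _] := hMbar; have hgbar := metallic_metric hJ.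
split; split.
- move=> D1int U nu u X Y oU hnu hu sX sY a x Ux.
  apply/esym/eqP; rewrite -subr_eq0.
  rewrite (cov_form_D1 hMbar hf hnabla hD a oU Ux hnu hu sX sY).
  rewrite (normal_formE hgbar hnu hu)//.
  have [-> _] := J_dmap_D1 hf hD (D1int U X Y oU sX sY x Ux).
  have [_ nuN _] := hnu.
  by rewrite (Defs.metric_sym hgbar) nuN// oppr0.
- move=> cov U X Y oU sX sY x Ux.
  have [B [nu [u [oB Bx BU hnu hu]]]] := exists_normal_frame J hgbar hf oU Ux.
  have {}sX := section_of_sub BU sX; have {}sY := section_of_sub BU sY.
  apply: (Npart_eq0 hq hJ hf hD); rewrite (hu x _ Bx) big1// => a _.
  have := cov_form_D1 hMbar hf hnabla hD a oB Bx hnu hu sX sY.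
  rewrite (cov B nu u X Y oB hnu hu sX sY a x Bx) subrr => /esym/eqP.
  by rewrite oppr_eq0 => /eqP ->; rewrite scale0r.
- move=> D2int U nu u X Y oU hnu hu sX sY x Ux.
  rewrite (Tpart_lie hMbar hf hnabla hnablaf oU hnu hu Ux (proj1 sX) (proj1 sY)).
  have /(proj1_Tpart_eq0 hq hJ hf hD) T0 := D2int U X Y oU sX sY x Ux.
  rewrite linearD /= T0 add0r linear_sum; apply: eq_bigr => a _.
  by rewrite linearB !linearZ.
- move=> P1eq U X Y oU sX sY x Ux.
  have [B [nu [u [oB Bx BU hnu hu]]]] := exists_normal_frame J hgbar hf oU Ux.
  have {}sX := section_of_sub BU sX; have {}sY := section_of_sub BU sY.
  apply/(proj1_Tpart_eq0 hq hJ hf hD).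
  have := P1eq B nu u X Y oB hnu hu sX sY x Bx.
  rewrite (Tpart_lie hMbar hf hnabla hnablaf oB hnu hu Bx (proj1 sX) (proj1 sY)).
  rewrite linearD /= linear_sum => /eqP; rewrite -subr_eq0 -addrA -sumrB big1 => [|a _].
    by rewrite addr0 => /eqP.
  by rewrite linearB !linearZ subrr.
Qed.
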